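(* Fix an eigenpair $(\lambda,u)$ of the nonlinear eigenvalue problem. Let $(\lambda_{h_n},u_{h_n})$ be the eigenpair approximation produced by the Eigenvalue Multigrid Scheme described in the context, where either (i) all correction steps are fixed-point correction steps, and Assumptions A1, A2 and B (stated in the context) hold; or (ii) all correction steps are Newton correction steps, and Assumptions A1, A2 and C (stated in the context) hold. Then there is a constant $C>0$ independent of the mesh sizes (the constant hidden in the inequalities $\lesssim$ concerned) such that, under the condition $C\beta^2\eta_a(V_H)<1$, $$\|u-u_{h_n}\|_1\lesssim \delta_{h_n}(u),$$ $$|\lambda-\lambda_{h_n}|+\|u-u_{h_n}\|_0\lesssim \eta_a(V_{h_n})\,\delta_{h_n}(u).$$
   Context: **Notation.** $x\lesssim y$ means $x\le C_1y$, and $x\approx y$ means $c_3x\le y\le C_3x$, with constants independent of the mesh sizes (in particular of the level indices $k$ and $n$). $\Omega\subset\mathbb{R}^d$ ($d=2,3$) is the computing domain, $V=H_0^1(\Omega)$, $\|\cdot\|_s$ is the $H^s(\Omega)$ norm ($s=0,1$), and $(\cdot,\cdot)$ is the $L^2(\Omega)$ inner product. **Problem.** $f(x,u)$ is a smooth enough function such that the following eigenvalue problem has only real eigenvalues: find $(\lambda,u)\in\mathbb{R}\times V$ with $b(u,u)=1$ and $a(u,v)=\lambda b(u,v)$ for all $v\in V$, where $$a(u,v)=\int_\Omega(\nabla u\cdot\nabla v+f(x,u)v)\,d\Omega,\qquad b(u,v)=\int_\Omega uv\,d\Omega .$$ (This is the weak form of $-\Delta u+f(x,u)=\lambda u$ in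 $\Omega$, $u=0$ on $\partial\Omega$, $\int_\Omega u^2=1$.) An eigenpair $(\lambda,u)$ is fixed, and all discrete eigenpairs below are the approximations of this eigenpair. $f_v(x,v)$ (also written $f_u$) denotes the derivative of $f$ in its second argument. **Finite element spaces.** $V_h\subset V$ are linear finite element spaces on shape-regular meshes $\mathcal{T}_h$ of mesh size $h$, with $\lim_{h\to0}\inf_{v\in V_h}\|w-v\|_1=0$ for every $w\in V$. Put $\delta_h(u)=\inf_{v_h\in V_h}\|u-v_h\|_1$. The direct finite element approximation in $V_h$ is $(\bar\lambda_h,\bar u_h)\in\mathbb{R}\times V_h$ with $b(\bar u_h,\bar u_h)=1$ and $a(\bar u_h,v_h)=\bar\lambda_h b(\bar u_h,v_h)$ for all $v_h\in V_h$. **Assumption A1.** $\|u-\bar u_h\|_1\lesssim\delta_h(u)$ and $|\lambda-\bar\lambda_h|+\|u-\bar u_h\|_0\lesssim\eta_a(V_h)\|u-\bar u_h\|_1$, where $\eta_a(V_h)$ depends on the finite-dimensional space $V_h$, $\lim_{h\to0}\eta_a(V_h)=0$, and $\eta_a(\widetilde V_h)\le\eta_a(V_h)$ if $V_h\subset\widetilde V_h\subset V$. **Assumption A2.** If $V^h$ is a subspace of $V_h$ and $(\lambda^h,u^h)\in\mathbb{R}\times V^h$ is the eigenpair approximation with $b(u^h,u^h)=1$ and $a(u^h,v^h)=\lambda^hb(u^h,v^h)$ for all $v^h\in V^h$, then $\|\bar u_h-u^h\|_1\lesssim\inf_{v^h\in V^h}\|\bar u_h-v^h\|_1$ and $|\bar\lambda_h-\lambda^h|+\|\bar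 u_h-u^h\|_0\lesssim\eta_a(V^h)\|\bar u_h-u^h\|_1$. **Assumption B.** $|(f(x,w)-f(x,v),\psi)|\lesssim\|w-v\|_0\|\psi\|_1$ for all $w,v,\psi\in V$. **Assumption C.** $|(f(x,w)-f(x,v)-f_v(x,v)(w-v),\psi)|\lesssim\|w-v\|_0\|\psi\|_1$ for all $w,v,\psi\in V$. **Sequence of spaces.** $V_H$ is the linear finite element space on a coarse mesh $\mathcal{T}_H$. $\mathcal{T}_{h_1}$ is obtained from $\mathcal{T}_H$ by regular refinement, and $\mathcal{T}_{h_k}$ from $\mathcal{T}_{h_{k-1}}$ by regular refinement (each element produces $\beta^d$ subelements, $\beta>1$), so $h_k\approx\frac1\beta h_{k-1}$ for $k=2,\dots,n$. The corresponding linear finite element spaces satisfy $V_H\subseteq V_{h_1}\subset V_{h_2}\subset\cdots\subset V_{h_n}$ and $\delta_{h_k}(u)\approx\frac1\beta\delta_{h_{k-1}}(u)$, $k=2,\dots,n$. **Fixed-point correction step** (from $(\lambda_{h_k},u_{h_k})\in\mathbb{R}\times V_{h_k}$ to $(\lambda_{h_{k+1}},u_{h_{k+1}})$). Let $\widehat u_{h_{k+1}}\in V_{h_{k+1}}$ solve $(\nabla\widehat u_{h_{k+1}},\nabla v)=\lambda_{h_k}b(u_{h_k},v)-(f(x,u_{h_k}),v)$ for all $v\in V_{h_{k+1}}$. A multigrid method yields $\widetilde u_{h_{k+1}}\in V_{h_{k+1}}$ with $\|\widehat u_{h_{k+1}}-\widetilde u_{h_{k+1}}\|_1\lesssim\eta_a(V_{h_k})\delta_{h_k}(u)$.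 Then put $V_{H,h_{k+1}}=V_H+\mathrm{span}\{\widetilde u_{h_{k+1}}\}$ and let $(\lambda_{h_{k+1}},u_{h_{k+1}})\in\mathbb{R}\times V_{H,h_{k+1}}$ be the eigenpair approximation with $b(u_{h_{k+1}},u_{h_{k+1}})=1$ and $a(u_{h_{k+1}},v)=\lambda_{h_{k+1}}b(u_{h_{k+1}},v)$ for all $v\in V_{H,h_{k+1}}$ (the approximation of Assumption A2 with $V_h=V_{h_{k+1}}$ and $V^h=V_{H,h_{k+1}}$). **Newton correction step.** Put $a_{h_k}(w,v)=(\nabla w,\nabla v)+(f_u(x,u_{h_k})w,v)$. For this step it is assumed that $L_u=-\Delta+f_u(x,u)$ is nonsingular and that $u_{h_k}$ is close enough to $u$ that $\sup_{0\ne v\in V_{h_{k+1}}}a_{h_k}(w,v)/\|v\|_1\gtrsim\|w\|_1$ for all $w\in V_{h_{k+1}}$ and $|a_{h_k}(w,v)|\lesssim\|w\|_1\|v\|_1$ for all $w,v\in V$. Let $\widehat e_{h_{k+1}}\in V_{h_{k+1}}$ solve $a_{h_k}(\widehat e_{h_{k+1}},v)=\lambda_{h_k}b(u_{h_k},v)-(\nabla u_{h_k},\nabla v)-(f(x,u_{h_k}),v)$ for all $v\in V_{h_{k+1}}$. A multigrid method yields $\widetilde e_{h_{k+1}}\in V_{h_{k+1}}$ with $\|\widehat e_{h_{k+1}}-\widetilde e_{h_{k+1}}\|_1\lesssim\eta_a(V_{h_k})\delta_{h_k}(u)$. Set $\widetilde u_{h_{k+1}}=u_{h_k}+\widetilde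 e_{h_{k+1}}$, then define $V_{H,h_{k+1}}$ and $(\lambda_{h_{k+1}},u_{h_{k+1}})$ exactly as in the fixed-point correction step. **Eigenvalue Multigrid Scheme.** (1) Construct the nested linear finite element spaces $V_{h_1},\dots,V_{h_n}$ on the successively refined meshes $\mathcal{T}_{h_1},\dots,\mathcal{T}_{h_n}$, such that $V_H\subseteq V_{h_1}\subset V_{h_2}\subset\cdots\subset V_{h_n}$ and $\delta_{h_k}(u)\approx\frac1\beta\delta_{h_{k-1}}(u)$ for $k=2,\dots,n$. (2) Solve the nonlinear eigenvalue problem directly in $V_{h_1}$: find $(\lambda_{h_1},u_{h_1})\in\mathbb{R}\times V_{h_1}$ with $b(u_{h_1},u_{h_1})=1$ and $a(u_{h_1},v)=\lambda_{h_1}b(u_{h_1},v)$ for all $v\in V_{h_1}$; thus $(\lambda_{h_1},u_{h_1})=(\bar\lambda_{h_1},\bar u_{h_1})$. (3) For $k=1,\dots,n-1$ obtain $(\lambda_{h_{k+1}},u_{h_{k+1}})$ from $(\lambda_{h_k},u_{h_k})$ by a correction step. The output is $(\lambda_{h_n},u_{h_n})$.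
   Formalization: The second estimate (eigenvalue and L² error) is false as stated if η_a can drop sharply between levels; it is proved under the added assumption η_a(V_{h_k}) ≲ β η_a(V_{h_{k+1}}) for 1 ≤ k < n. The first estimate needs no addition. *)

(* Defs.v *)
From HB Require Import structures.
From mathcomp Require Import all_boot all_order all_algebra.
From mathcomp Require Import all_classical all_reals all_analysis.

Set Implicit Arguments.
Unset Strict Implicit.
Unset Printing Implicit Defensive.

Import Order.TTheory GRing.Theory Num.Theory.
Import numFieldNormedType.Exports.

Local Open Scope classical_set_scope.
Local Open Scope ring_scope.

Section lebesgue_tuple.
Context {R : realType}.

Definition tuple_cons (d : nat) (p : (measurableTypeR R * d.-tuple (measurableTypeR R))%type) :
  d.+1.-tuple (measurableTypeR R) := [tuple of p.1 :: p.2].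

Lemma measurable_tuple_cons d : measurable_fun setT (@tuple_cons d).
Proof. exact: (@measurable_cons _ _ _ _ fst _ snd). Qed.

HB.instance Definition _ d :=
  isMeasurableFun.Build _ _ _ _ (@tuple_cons d) (@measurable_tuple_cons d).

Section cons_measure.
Local Open Scope ereal_scope.
Variables (d : nat) (m : {sigma_finite_measure set (d.-tuple (measurableTypeR R)) -> \bar R}).

Definition cons_measure := pushforward (@lebesgue_measure R \x m) (@tuple_cons d).

Let pfm : {measure set (d.+1.-tuple (measurableTypeR R)) -> \bar R} :=
  measure_function_pushforward__canonical__measure_function_Measure
    (@lebesgue_measure R \x m) (@measurable_tuple_cons d).

HB.instance Definition _ := isMeasure.Build _ _ _ cons_measure
  (measure0 pfm) (@measure_ge0 _ _ _ pfm) (@measure_semi_sigma_additive _ _ _ pfm).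

Let cons_measure_sigma_finite : sigma_finite setT cons_measure.
Proof.
have /sigma_finiteP[F [TF ndF Foo]] := sigma_finiteT (@lebesgue_measure R).
have /sigma_finiteP[G [TG ndG Goo]] := sigma_finiteT m.
pose g (t : d.+1.-tuple (measurableTypeR R)) := (thead t, [tuple of behead t]).
have mg : measurable_fun setT g.
  apply/measurable_fun_pair; first exact: measurable_tnth.
  exact: measurable_behead.
exists (fun n => g @^-1` (F n `*` G n)).
  rewrite -preimage_bigcup (_ : \bigcup_n _ = setT) ?preimage_setT//.
  apply/seteqP; split=> // -[x t] _.
  have : [set: measurableTypeR R] x by [].
  have : [set: d.-tuple (measurableTypeR R)] t by [].
  rewrite TF TG => -[j _ Gj] [i _ Fi]; exists (maxn i j) => //; split.
    by move: Fi; exact/subsetPset/ndF/leq_maxl.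
  by move: Gj; exact/subsetPset/ndG/leq_maxr.
move=> n; have [mF Fn] := Foo n; have [mG Gn] := Goo n; split.
  by rewrite -[X in measurable X]setTI; apply: mg => //; exact: measurableX.
rewrite /cons_measure /pushforward -comp_preimage (_ : g \o _ = id).
  by rewrite /= product_measure1E// lte_mul_pinfty// ge0_fin_numE.
by apply/funext => -[x t]; congr pair; exact: val_inj.
Qed.

HB.instance Definition _ := Measure_isSigmaFinite.Build _ _ _ cons_measure
  cons_measure_sigma_finite.

End cons_measure.

(* Lebesgue measure on R^d, as an iterated product. *)
Fixpoint leb (d : nat) : {sigma_finite_measure set (d.-tuple (measurableTypeR R)) -> \bar R} :=
  match d with
  | 0 => \d_ [tuple]
  | e.+1 => cons_measure (leb e)
  end.

End lebesgue_tuple.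

Section sobolev.
Context {R : realType} {d : nat}.
Implicit Types (Omega D : set 'rV[R]_d) (g : 'rV[R]_d -> R).

Definition pt (t : d.-tuple (measurableTypeR R)) : 'rV[R]_d := \row_i tnth t i.

Definition measurable_on D g : Prop :=
  measurable_fun [set t | D (pt t)] (g \o pt).

Definition integrable_on D g : Prop :=
  (leb d).-integrable [set t | D (pt t)] (fun t => (g (pt t))%:E).

Definition integ D g : R := \int[leb d]_(t in [set t | D (pt t)]) g (pt t).

Definition L2 D g : Prop :=
  measurable_on D g /\ integrable_on D (fun x => g x ^+ 2).

Fixpoint partial (s : seq 'I_d) g : 'rV[R]_d -> R :=
  if s is i :: s' then fun x => 'D_(delta_mx 0 i) (partial s' g) x else g.

Definition test_function Omega (phi : 'rV[R]_d -> R) : Prop :=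
  (forall s, continuous (partial s phi) /\
     forall i x, derivable (partial s phi) x (delta_mx 0 i)) /\
  exists K, [/\ compact K, K `<=` Omega & forall x, ~ K x -> phi x = 0].

(* A weakly differentiable function is carried together with its weak gradient:
   the pair (w, g) stands for w with d_i w = g i. *)
Definition h1fun : Type := (('rV[R]_d -> R) * ('I_d -> 'rV[R]_d -> R))%type.

Implicit Types (v w psi : h1fun) (W : set h1fun).

Definition of_test (phi : 'rV[R]_d -> R) : h1fun :=
  (phi, fun i => partial [:: i] phi).

Definition b_form Omega (v psi : h1fun) : R := integ Omega (fun x => v.1 x * psi.1 x).

Definition grad_dot (v psi : h1fun) (x : 'rV[R]_d) : R :=
  \sum_(i < d) v.2 i x * psi.2 i x.

Definition grad_form Omega (v psi : h1fun) : R := integ Omega (grad_dot v psi).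

Definition l2norm Omega (v : h1fun) : R := Num.sqrt (b_form Omega v v).

Definition h1norm Omega (v : h1fun) : R :=
  Num.sqrt (b_form Omega v v + grad_form Omega v v).

(* H^1_0(Omega): closure of the test functions, paired with their classical
   gradients, in the H^1 norm.  The second component of an element is a weak
   gradient of the first one, hence determined by it almost everywhere; elements
   are not identified when they agree almost everywhere. *)
Definition H10 Omega : set h1fun := [set v |
  [/\ L2 Omega v.1, forall i, L2 Omega (v.2 i) &
      exists phi : nat -> 'rV[R]_d -> R,
        (forall n, test_function Omega (phi n)) /\
        ((fun n => h1norm Omega (v - of_test (phi n))) @ \oo --> (0 : R))]].

Definition subspace W : Prop :=
  W 0 /\ forall (a : R) v w, W v -> W w -> W (a *: v + w).

Definition best_approx Omega W (v : h1fun) : R :=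
  inf [set h1norm Omega (v - w) | w in W].

End sobolev.

Arguments h1fun : clear implicits.

Section finite_elements.
Context {R : realType} {d : nat}.

Definition simplex : Type := 'M[R]_(d.+1, d).
Definition mesh : Type := seq simplex.
Implicit Types (K : simplex) (T : mesh) (Omega : set 'rV[R]_d).

(* Convex hull of the vertices (rows) of K with index in S. *)
Definition face K (S : {set 'I_d.+1}) : set 'rV[R]_d := [set x |
  exists a : 'rV[R]_d.+1,
    [/\ forall i, 0 <= a 0 i, forall i, i \notin S -> a 0 i = 0,
        \sum_i a 0 i = 1 & x = a *m K]].

Definition cell K : set 'rV[R]_d := face K [set: 'I_d.+1].

Definition nondegenerate K : Prop :=
  row_free (row_mx (const_mx 1 : 'cV[R]_d.+1) K).

Definition enorm (x : 'rV[R]_d) : R := Num.sqrt (\sum_i x 0 i ^+ 2).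

Definition diam K : R :=
  sup [set r | exists x y, [/\ cell K x, cell K y & r = enorm (x - y)]].

Definition mesh_size T : R := \big[Num.max/0]_(K <- T) diam K.

Definition is_mesh Omega T : Prop :=
  [/\ uniq T, {in T &, injective cell}, {in T, forall K, nondegenerate K},
      \bigcup_(K in [set` T]) cell K = closure Omega &
      {in T &, forall K K', cell K `&` cell K' =
         face K [set i | [exists j, row i K == row j K']]}].

Definition shape_regular (F : set mesh) : Prop := exists2 sigma : R, 0 < sigma &
  forall T, F T -> {in T, forall K, exists x r,
    [/\ 0 < r, [set y | enorm (y - x) <= r] `<=` cell K & diam K <= sigma * r]}.

Definition refines T T' : Prop :=
  (forall K', K' \in T' -> exists2 K, K \in T & cell K' `<=` cell K) /\
  (forall K, K \in T -> cell K =
     \bigcup_(K' in [set K' | K' \in T' /\ cell K' `<=` cell K]) cell K').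

Definition regular_refinement (beta : R) T T' : Prop :=
  refines T T' /\
  forall K, K \in T ->
    (count (fun K' => `[< cell K' `<=` cell K >]) T')%:R = beta ^+ d.

Definition affine_on (A : set 'rV[R]_d) (w : 'rV[R]_d -> R) : Prop :=
  exists (g : 'cV[R]_d) (c : R), forall x, A x -> w x = (x *m g) 0 0 + c.

(* Linear finite elements with zero boundary values. *)
Definition fe_space Omega T : set (h1fun R d) := [set v |
  [/\ H10 Omega v, {within closure Omega, continuous v.1} &
      {in T, forall K, affine_on (cell K) v.1}]].

End finite_elements.

Arguments simplex : clear implicits.
Arguments mesh : clear implicits.

Section problem.
Context {R : realType} {d : nat}.
Variables (Omega : set 'rV[R]_d) (f : 'rV[R]_d -> R -> R).
Implicit Types (v w psi : h1fun R d) (W : set (h1fun R d)).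

Local Notation V := (H10 Omega).
Local Notation b := (b_form Omega).
Local Notation grad := (grad_form Omega).
Local Notation norm0 := (l2norm Omega).
Local Notation norm1 := (h1norm Omega).

Definition computing_domain : Prop :=
  [/\ open Omega, connected Omega, bounded_set Omega & Omega !=set0].

Definition f_v (x : 'rV[R]_d) (t : R) : R := derive1 (f x) t.

(* (f(x,w), psi) *)
Definition f_form w psi : R := integ Omega (fun x => f x (w.1 x) * psi.1 x).

(* (f_v(x,z) w, psi) *)
Definition fv_form (z w psi : h1fun R d) : R :=
  integ Omega (fun x => f_v x (z.1 x) * w.1 x * psi.1 x).

Definition a_form w psi : R :=
  integ Omega (fun x => grad_dot w psi x + f x (w.1 x) * psi.1 x).

(* "Smooth enough": C^1 in the second argument, and the form a is well defined
   on V x V. *)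
Definition smooth_enough : Prop :=
  [/\ forall x t, Omega x -> {for (x, t), continuous (fun p => f p.1 p.2)},
      forall x t, Omega x -> derivable (f x) t 1,
      forall x t, Omega x -> {for (x, t), continuous (fun p => f_v p.1 p.2)} &
      forall w psi, V w -> V psi ->
        integrable_on Omega (fun x => f x (w.1 x) * psi.1 x)].

Definition is_eigenpair W (mu : R) (w : h1fun R d) : Prop :=
  [/\ W w, b w w = 1 & forall v, W v -> a_form w v = mu * b w v].

Definition assumption_B (c : R) : Prop := forall w v psi, V w -> V v -> V psi ->
  `|integ Omega (fun x => (f x (w.1 x) - f x (v.1 x)) * psi.1 x)|
    <= c * (norm0 (w - v) * norm1 psi).

(* The first clause says that the pairings with f_v are well defined. *)
Definition assumption_C (c : R) : Prop :=
  (forall v w psi, V v -> V w -> V psi ->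
     integrable_on Omega (fun x => f_v x (v.1 x) * w.1 x * psi.1 x)) /\
  forall w v psi, V w -> V v -> V psi ->
  `|integ Omega (fun x => (f x (w.1 x) - f x (v.1 x)
       - f_v x (v.1 x) * (w.1 x - v.1 x)) * psi.1 x)|
    <= c * (norm0 (w - v) * norm1 psi).

(* (grad w, grad psi) + (f_u(x,z) w, psi): for z = u_{h_k} the Newton form, for
   z = u the weak form of the operator L_u. *)
Definition linearized_form (z w psi : h1fun R d) : R := grad w psi + fv_form z w psi.

(* L_u = -Delta + f_u(x,u), as an operator from V to its dual, is bijective. *)
Definition linearization_nonsingular (u : h1fun R d) : Prop :=
  forall l : h1fun R d -> R,
    (forall (a : R) v w, V v -> V w -> l (a *: v + w) = a * l v + l w) ->
    (exists M : R, forall v, V v -> `|l v| <= M * norm1 v) ->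
    exists w, [/\ V w, forall v, V v -> linearized_form u w v = l v &
      forall w', V w' -> (forall v, V v -> linearized_form u w' v = l v) ->
        norm1 (w - w') = 0].

Section approximation.
Variables (lambda : R) (u : h1fun R d).

Local Notation delta W := (best_approx Omega W u).
Local Notation fe := (fe_space Omega).

(* [F] is the family of meshes T_h; [lbar T], [ubar T] is the direct finite
   element approximation of (lambda, u) on T; [eta] is eta_a; [approximates W mu w]
   tells which of the discrete eigenpairs in a subspace W is regarded as the
   approximation of the fixed eigenpair (lambda, u); [c] is a common bound for the
   hidden constants of the hypotheses. *)
Variables (F : set (mesh R d)) (lbar : mesh R d -> R) (ubar : mesh R d -> h1fun R d)
  (eta : set (h1fun R d) -> R)
  (approximates : set (h1fun R d) -> R -> h1fun R d -> Prop) (c : R).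

Definition eigenpair_approximation W (mu : R) (w : h1fun R d) : Prop :=
  is_eigenpair W mu w /\ approximates W mu w.

Definition fe_family : Prop :=
  [/\ forall T, F T -> is_mesh Omega T, shape_regular F,
      forall w, V w -> forall e : R, 0 < e -> exists2 h0 : R, 0 < h0 &
        forall T, F T -> mesh_size T < h0 -> best_approx Omega (fe T) w < e &
      forall T, F T -> is_eigenpair (fe T) (lbar T) (ubar T)].

Definition eta_properties : Prop :=
  [/\ forall W, 0 <= eta W,
      forall e : R, 0 < e -> exists2 h0 : R, 0 < h0 &
        forall T, F T -> mesh_size T < h0 -> eta (fe T) < e &
      forall T W, F T -> subspace W -> fe T `<=` W -> W `<=` V ->
        eta W <= eta (fe T)].

Definition assumption_A1 : Prop :=
  eta_properties /\
  forall T, F T ->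
    norm1 (u - ubar T) <= c * delta (fe T) /\
    `|lambda - lbar T| + norm0 (u - ubar T) <= c * (eta (fe T) * norm1 (u - ubar T)).

Definition assumption_A2 : Prop := forall T W mu w,
  F T -> subspace W -> W `<=` fe T -> eigenpair_approximation W mu w ->
    norm1 (ubar T - w) <= c * best_approx Omega W (ubar T) /\
    `|lbar T - mu| + norm0 (ubar T - w) <= c * (eta W * norm1 (ubar T - w)).

Inductive correction := FixedPoint | Newton.

(* The correction space V_H + span{ut}. *)
Definition enriched W (ut : h1fun R d) : set (h1fun R d) :=
  [set v | exists2 w, W w & exists t : R, v = w + t *: ut].

Definition fixed_point_update (T T' : mesh R d) (lk : R) (uk : h1fun R d)
    (ut : h1fun R d) : Prop :=
  exists uh : h1fun R d,
    [/\ fe T' uh,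
        forall v, fe T' v -> grad uh v = lk * b uk v - f_form uk v,
        fe T' ut & norm1 (uh - ut) <= c * (eta (fe T) * delta (fe T))].

Definition newton_stable (T' : mesh R d) (uk : h1fun R d) : Prop :=
  (forall w, fe T' w -> norm1 w <=
     c * sup [set linearized_form uk w v / norm1 v | v in fe T' `&` [set v | norm1 v != 0]]) /\
  (forall w v, V w -> V v -> `|linearized_form uk w v| <= c * (norm1 w * norm1 v)).

Definition newton_update (T T' : mesh R d) (lk : R) (uk : h1fun R d)
    (ut : h1fun R d) : Prop :=
  newton_stable T' uk /\
  exists eh et : h1fun R d,
    [/\ fe T' eh,
        forall v, fe T' v ->
          linearized_form uk eh v = lk * b uk v - grad uk v - f_form uk v,
        fe T' et, norm1 (eh - et) <= c * (eta (fe T) * delta (fe T)) & ut = uk + et].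

Definition update (kind : correction) :=
  match kind with
  | FixedPoint => fixed_point_update
  | Newton => newton_update
  end.

Definition correction_step (kind : correction) (TH T T' : mesh R d)
    (lk : R) (uk : h1fun R d) (lk1 : R) (uk1 : h1fun R d) : Prop :=
  exists2 ut, update kind T T' lk uk ut &
    eigenpair_approximation (enriched (fe TH) ut) lk1 uk1.

Definition approx (x y : R) : Prop := c^-1 * x <= y <= c * x.

(* Levels are numbered 1, ..., n; [T k] is the mesh T_{h_k}. *)
Definition mesh_hierarchy (beta : R) (n : nat) (TH : mesh R d)
    (T : nat -> mesh R d) : Prop :=
  [/\ F TH /\ (forall k, (1 <= k <= n)%N -> F (T k)),
      refines TH (T 1%N) /\ fe TH `<=` fe (T 1%N),
      forall k, (1 <= k < n)%N -> regular_refinement beta (T k) (T k.+1) /\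
        fe (T k) `<=` fe (T k.+1),
      forall k, (1 <= k < n)%N ->
        approx (mesh_size (T k.+1)) (beta^-1 * mesh_size (T k)) &
      forall k, (1 <= k < n)%N ->
        approx (delta (fe (T k.+1))) (beta^-1 * delta (fe (T k)))].

Definition multigrid_scheme (kind : correction) (beta : R) (n : nat) (TH : mesh R d)
    (T : nat -> mesh R d) (l_ : nat -> R) (u_ : nat -> h1fun R d) : Prop :=
  [/\ mesh_hierarchy beta n TH T,
      l_ 1%N = lbar (T 1%N), u_ 1%N = ubar (T 1%N) &
      forall k, (1 <= k < n)%N ->
        correction_step kind TH (T k) (T k.+1) (l_ k) (u_ k) (l_ k.+1) (u_ k.+1)].

(* eta_a(V_{h_k}) <~ beta eta_a(V_{h_{k+1}}): eta_a does not drop faster than the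
   mesh size.  Monotonicity of eta_a only gives the opposite comparison, and an
   L^2 estimate by eta_a of the finest space needs this one: the algebraic error
   is controlled by the values of eta_a on the coarser levels. *)
Definition eta_level_scaling (beta : R) (n : nat) (T : nat -> mesh R d) : Prop :=
  forall k, (1 <= k < n)%N -> eta (fe (T k)) <= c * (beta * eta (fe (T k.+1))).

End approximation.

End problem.

(* Main.v *)
(* With eps_k the H^1 distance between u_{h_k} and the direct finite element
   solution, one correction step gives
     eps_{k+1} <= K (eta(V_{h_k}) delta_{h_k} + eta(V_H) eps_k),   eps_1 = 0.
   Indeed, by (B) or (C) the residual of the direct solution in the auxiliary
   linear problem is bounded by the error of lambda_{h_k} plus the L^2 error of
   u_{h_k}, and A1 and A2 gain a factor eta on both; the problem is stable by the
   Poincare inequality (fixed point) or by assumption (Newton), and A2 says that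
   the new eigenfunction is quasi-optimal in a space that contains the iterate.
   As delta loses at most a factor c beta per level, the recurrence is
   contractive once beta^2 eta(V_H) is small, and so is the one obtained when
   eta(V_{h_k}) is also traded for c beta eta(V_{h_{k+1}}).

   The Poincare inequality is proved line by line for test functions, from
   (x g^2)' = g^2 + 2 x g g', then integrated by Fubini and passed to the limit. *)

Require Import Defs.
From mathcomp Require Import all_boot all_order all_algebra.
From mathcomp Require Import all_classical all_reals all_analysis.
From mathcomp Require Import measurable_realfun ring lra.

Import Order.TTheory GRing.Theory Num.Theory.
Import numFieldNormedType.Exports.

Set Implicit Arguments.
Unset Strict Implicit.
Unset Printing Implicit Defensive.

Local Open Scope classical_set_scope.
Local Open Scope ring_scope.

(** * Positive semidefinite forms: Cauchy-Schwarz and the associated seminorm *)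

Section semi_inner_product.
Context {R : rcfType} {V : lmodType R}.
Implicit Types (S : set V) (B : V -> V -> R) (x y z : V).

Definition lin_closed S := forall (a : R) x y, S x -> S y -> S (a *: x + y).

(* Linearity is required on [S] only: the integrals that define the forms below
   take junk values on nonintegrable functions. *)
Definition semi_inner S B :=
  [/\ forall a x y z, S x -> S y -> S z -> B (a *: x + y) z = a * B x z + B y z,
      forall x y, B x y = B y x & forall x, 0 <= B x x].

Variables (S : set V) (B : V -> V -> R).
Hypotheses (S0 : S 0) (SL : lin_closed S) (BI : semi_inner S B).

Local Notation nrm x := (Num.sqrt (B x x)).

Lemma lin_closedZ a x : S x -> S (a *: x).
Proof. by move=> Sx; rewrite -[_ *: _]addr0; apply: SL. Qed.

Lemma lin_closedD x y : S x -> S y -> S (x + y).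
Proof. by move=> Sx Sy; rewrite -[x]scale1r; apply: SL. Qed.

Lemma lin_closedB x y : S x -> S y -> S (x - y).
Proof. by move=> Sx Sy; rewrite addrC -scaleN1r; apply: SL. Qed.

Lemma semi_innerPl a x y z : S x -> S y -> S z ->
  B (a *: x + y) z = a * B x z + B y z.
Proof. by case: BI => + _ _; apply. Qed.

Lemma semi_innerC x y : B x y = B y x.
Proof. by case: BI. Qed.

Lemma semi_inner_ge0 x : 0 <= B x x.
Proof. by case: BI. Qed.

Lemma semi_innerBl x y z : S x -> S y -> S z -> B (x - y) z = B x z - B y z.
Proof.
by move=> Sx Sy Sz; rewrite addrC -scaleN1r semi_innerPl// mulN1r addrC.
Qed.

Lemma semi_innerP2 a x y : S x -> S y ->
  B (a *: x + y) (a *: x + y) = a ^+ 2 * B x x + 2 * a * B x y + B y y.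
Proof.
move=> Sx Sy; have Sxy := SL a Sx Sy.
rewrite semi_innerPl// ![B _ (_ + _)]semi_innerC !semi_innerPl// (semi_innerC y x).
by ring.
Qed.

Lemma cauchy_schwarz_sqr x y : S x -> S y -> B x y ^+ 2 <= B x x * B y y.
Proof.
move=> Sx Sy; have [y0|] := eqVneq (B y y) 0.
  have H t : 0 <= 2 * t * B x y + B x x.
    have := semi_inner_ge0 (t *: y + x).
    by rewrite semi_innerP2// y0 mulr0 add0r (semi_innerC y x).
  rewrite y0 mulr0; have [->|n0] := eqVneq (B x y) 0; first by rewrite expr0n.
  (* When [B y y = 0], the quadratic in [t] degenerates to an affine function. At this [t] it equals
     -1, which contradicts its nonnegativity. *)
  have := H (- (B x x + 1) / (2 * B x y)).
  have -> : 2 * (- (B x x + 1) / (2 * B x y)) * B x y = - (B x x + 1) by field.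
  lra.
move=> yn0; have y0 : 0 < B y y by rewrite lt_def yn0 semi_inner_ge0.
(* The coefficient of [y] minimizes the quadratic, which leaves the Schur complement
   [B x x - B x y ^+ 2 / B y y]. *)
have := semi_inner_ge0 ((- B x y / B y y) *: y + x).
rewrite semi_innerP2// (semi_innerC y x).
have -> : (- B x y / B y y) ^+ 2 * B y y + 2 * (- B x y / B y y) * B x y + B x x
   = B x x - B x y ^+ 2 / B y y by field.
by rewrite subr_ge0 ler_pdivrMr.
Qed.

Lemma cauchy_schwarz x y : S x -> S y -> `|B x y| <= nrm x * nrm y.
Proof.
move=> Sx Sy; rewrite -sqrtrM ?semi_inner_ge0// -sqrtr_sqr.
by rewrite ler_wsqrtr// cauchy_schwarz_sqr.
Qed.

Lemma semi_normD x y : S x -> S y -> nrm (x + y) <= nrm x + nrm y.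
Proof.
move=> Sx Sy; rewrite -[leRHS]ger0_norm ?addr_ge0 ?sqrtr_ge0//.
rewrite -sqrtr_sqr ler_wsqrtr// -[x]scale1r semi_innerP2// scale1r.
rewrite sqrrD !sqr_sqrtr ?semi_inner_ge0// expr1n !mul1r mulr1 lerD2r lerD2l.
by rewrite -[leRHS]mulr_natl ler_pM2l// (le_trans (ler_norm _))// cauchy_schwarz.
Qed.

Lemma semi_normZ a x : S x -> nrm (a *: x) = `|a| * nrm x.
Proof.
(* Values at 0 come from linearity for the combination [(-1) *: x + x]. *)
move=> Sx; have B00 : B 0 0 = 0.
  by have := semi_innerPl (-1) S0 S0 S0; rewrite scaleN1r addNr; lra.
have Bx0 : B x 0 = 0.
  by rewrite semi_innerC; have := semi_innerPl (-1) Sx Sx Sx; rewrite scaleN1r addNr; lra.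
have := semi_innerP2 a Sx S0; rewrite addr0 B00 Bx0 mulr0 !addr0 => ->.
by rewrite sqrtrM ?sqr_ge0// sqrtr_sqr.
Qed.

Lemma semi_norm0 : nrm 0 = 0.
Proof. by have := semi_normZ 0 S0; rewrite scale0r normr0 mul0r. Qed.

Lemma semi_normN x : S x -> nrm (- x) = nrm x.
Proof. by move=> Sx; rewrite -scaleN1r semi_normZ// normrN1 mul1r. Qed.

Lemma semi_norm_sub x y : S x -> S y -> nrm (x - y) = nrm (y - x).
Proof. by move=> Sx Sy; rewrite -opprB semi_normN//; exact: lin_closedB. Qed.

Lemma semi_norm_dist x y z : S x -> S y -> S z ->
  nrm (x - z) <= nrm (x - y) + nrm (y - z).
Proof.
by move=> Sx Sy Sz; rewrite -[x - z](subrKA y) semi_normD//; apply: lin_closedB.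
Qed.

End semi_inner_product.

(** * Square-integrable functions and the forms of the problem *)

Section square_integrable.
Context {R : realType} {d : nat} (Omega : set 'rV[R]_d).
Hypothesis mO : measurable [set t : d.-tuple (measurableTypeR R) | Omega (pt t)].
Implicit Types g h : 'rV[R]_d -> R.

(** The product is dominated by [g ^+ 2 + h ^+ 2], because [|a b| <= a ^+ 2 + b ^+ 2]. *)
Lemma L2_mul g h : L2 Omega g -> L2 Omega h -> integrable_on Omega (fun x => g x * h x).
Proof.
move=> [mg ig] [mh ih].
apply: (le_integrable mO _ _ (integrableD mO ig ih)).
  exact/measurable_EFinP/measurable_funM.
move=> t _ /=; rewrite lee_fin normrM.
rewrite [leRHS]ger0_norm ?addr_ge0 ?sqr_ge0//.
move: (g _) (h _) => a b.
rewrite -(real_normK (num_real a)) -(real_normK (num_real b)).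
have := sqr_ge0 (`|a| - `|b|); have := mulr_ge0 (normr_ge0 a) (normr_ge0 b).
rewrite sqrrB; lra.
Qed.

Lemma L2P (a : R) g h : L2 Omega g -> L2 Omega h -> L2 Omega (fun x => a * g x + h x).
Proof.
move=> Lg Lh; split.
  have [[mg _] [mh _]] := (Lg, Lh).
  by apply: measurable_funD => //; apply: measurable_funM.
have := integrableD mO (integrableD mO (integrableZl mO (a ^+ 2) Lg.2)
  (integrableZl mO (2 * a) (L2_mul Lg Lh))) Lh.2.
apply: eq_integrable => // t _ /=.
by rewrite -!EFinM -!EFinD; congr EFin; ring.
Qed.

Lemma L2_0 : L2 Omega (fun=> 0).
Proof.
split; first exact: measurable_cst.
have := integrable0 (leb d) [set t | Omega (pt t)].
by apply: eq_integrable => // t _ /=; rewrite expr0n.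
Qed.

(** The domain on which the forms are bilinear. It contains H^1_0 as well as the test functions with
    their gradients, so the semi-inner product lemmas cover differences of the two. *)
Definition integrable_h1 : set (h1fun R d) :=
  [set v | L2 Omega v.1 /\ forall i, L2 Omega (v.2 i)].

Lemma h1fun_lin1 (a : R) (v w : h1fun R d) :
  (a *: v + w).1 = (fun x => a * v.1 x + w.1 x).
Proof. by []. Qed.

Lemma h1fun_lin2 (a : R) (v w : h1fun R d) i :
  (a *: v + w).2 i = (fun x => a * v.2 i x + w.2 i x).
Proof. by []. Qed.

Lemma integrable_h1_lin : lin_closed integrable_h1.
Proof.
move=> a v w [Lv Lv'] [Lw Lw']; split; first by rewrite h1fun_lin1; exact: L2P.
by move=> i; rewrite h1fun_lin2; exact: L2P (Lv' i) (Lw' i).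
Qed.

Lemma integrable_h1_0 : integrable_h1 0.
Proof. by split=> [|i]; exact: L2_0. Qed.

Lemma integ_lin (a : R) g h : integrable_on Omega g -> integrable_on Omega h ->
  integ Omega (fun x => a * g x + h x) = a * integ Omega g + integ Omega h.
Proof.
move=> ig ih; rewrite /integ RintegralD// ?RintegralZl//.
exact: (integrableZl mO a ig).
Qed.

Lemma grad_dot_integrable v w : integrable_h1 v -> integrable_h1 w ->
  integrable_on Omega (grad_dot v w).
Proof.
move=> [_ Lv] [_ Lw].
have := integrable_sum mO (index_enum 'I_d) (fun i (_ : xpredT i) => L2_mul (Lv i) (Lw i)).
by apply: eq_integrable => // t _ /=; rewrite sumEFin.
Qed.

Lemma grad_dot_lin (a : R) (v w z : h1fun R d) :
  grad_dot (a *: v + w) z = (fun x => a * grad_dot v z x + grad_dot w z x).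
Proof.
apply/funext => x; rewrite /grad_dot mulr_sumr -big_split.
by apply: eq_bigr => i _; rewrite h1fun_lin2 mulrDl mulrA.
Qed.

Lemma semi_inner_b : semi_inner integrable_h1 (b_form Omega).
Proof.
split.
- move=> a x y z [Lx _] [Ly _] [Lz _].
  rewrite /b_form h1fun_lin1 -integ_lin; [|exact: L2_mul..].
  by apply: eq_Rintegral => t _; rewrite mulrDl mulrA.
- by move=> x y; apply: eq_Rintegral => t _; rewrite mulrC.
- by move=> x; apply: Rintegral_ge0 => t _; rewrite -expr2 sqr_ge0.
Qed.

Lemma semi_inner_grad : semi_inner integrable_h1 (grad_form Omega).
Proof.
split.
- move=> a x y z Lx Ly Lz.
  rewrite /grad_form -integ_lin; [|exact: grad_dot_integrable..].
  by congr integ; exact: grad_dot_lin.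
- move=> x y; apply: eq_Rintegral => t _; apply: eq_bigr => i _.
  by rewrite mulrC.
- move=> x; apply: Rintegral_ge0 => t _; apply: sumr_ge0 => i _.
  by rewrite -expr2 sqr_ge0.
Qed.

(** The seminorm of this form unfolds to [h1norm], so the general seminorm lemmas apply to [h1norm]
    directly. *)
Definition h1_form (v w : h1fun R d) := b_form Omega v w + grad_form Omega v w.

Lemma semi_inner_h1 : semi_inner integrable_h1 h1_form.
Proof.
have [bl bC b0] := semi_inner_b; have [gl gC g0] := semi_inner_grad.
split=> [a x y z Lx Ly Lz|x y|x].
- by rewrite /h1_form bl// gl//; ring.
- by rewrite /h1_form bC gC.
- by rewrite addr_ge0.
Qed.

Lemma l2norm_le_h1norm v : l2norm Omega v <= h1norm Omega v.
Proof. by rewrite ler_wsqrtr// lerDl; case: semi_inner_grad. Qed.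

End square_integrable.

(** * Measurability of open sets and continuous functions through [pt] *)

Section lebesgue_on_row_vectors.
Context {R : realType} {d : nat}.

Lemma measurable_tuple_forall (A : 'I_d -> set (measurableTypeR R)) :
  (forall i, measurable (A i)) -> measurable [set t : d.-tuple _ | forall i, A i (tnth t i)].
Proof.
move=> mA; have -> : [set t : d.-tuple (measurableTypeR R) | forall i, A i (tnth t i)] =
    \bigcap_(i in [set: 'I_d]) ((@tnth _ (measurableTypeR R))^~ i @^-1` A i).
  by apply/seteqP; split=> [t H i _|t H i]; [exact: H|exact: (H i Logic.I)].
apply: fin_bigcap_measurable => // i _.
by rewrite -[X in measurable X]setTI; apply: measurable_tnth.
Qed.

Let row_box (q : d.-tuple rat) (k : nat) : set (d.-tuple (measurableTypeR R)) :=
  [set t | forall i, `|tnth t i - ratr (tnth q i)| < k.+1%:R^-1].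

(** The sigma-algebra on tuples makes the coordinates measurable, so boxes are measurable. An open
    set is the union of the rational boxes it contains, and there are countably many of these. *)
Lemma measurable_pt_open (U : set 'rV[R]_d) : open U ->
  measurable [set t : d.-tuple (measurableTypeR R) | U (pt t)].
Proof.
move=> oU.
(* The first condition does not involve [t], so [F p] is either a whole box or empty. *)
pose F (p : d.-tuple rat * nat) : set (d.-tuple (measurableTypeR R)) :=
  [set t | row_box p.1 p.2 `<=` [set t | U (pt t)] /\ row_box p.1 p.2 t].
have -> : [set t | U (pt t)] = \bigcup_p F p.
  apply/seteqP; split=> [t Ut|t [p _ [pU tp]]]; last exact: pU.
  have /nbhs_ballP[e /= e0 eU] := open_nbhs_nbhs (conj oU Ut).
  (* Two points of a box are both within the radius of its rational centre, so twice the radius must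
     stay below [e]. *)
  have [k ke] : exists k, k.+1%:R^-1 + k.+1%:R^-1 < e.
    have [k] := ltr_add_invr (divr_gt0 e0 (ltr0Sn R 1)).
    rewrite add0r => ke; exists k; move: ke; set x := k.+1%:R^-1; lra.
  have k0 : 0 < k.+1%:R^-1 :> R by rewrite invr_gt0.
  have /choice[q qP] : forall i, exists q : rat, `|tnth t i - ratr q| < k.+1%:R^-1.
    move=> i; move: k0; set r := k.+1%:R^-1 => k0.
    have /rat_in_itvoo[q] : tnth t i - r < tnth t i + r by lra.
    rewrite in_itv /= => /andP[q1 q2]; exists q.
    by rewrite ltr_norml; apply/andP; split; lra.
  have boxU : row_box [tuple q i | i < d] k `<=` [set t | U (pt t)].
    move=> s sB; apply: eU; split => // i0 i; rewrite !mxE.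
    rewrite -ball_normE /=.
    have := sB i; rewrite tnth_mktuple distrC => sq.
    rewrite -(subrKA (ratr (q i))); apply: (le_lt_trans (ler_normD _ _)).
    by apply: lt_trans ke; apply: ltrD.
  exists ([tuple q i | i < d], k) => //; split => // i.
  by rewrite tnth_mktuple.
apply: countable_bigcupT_measurable => // p; rewrite /F.
have [pU|npU] := pselect (row_box p.1 p.2 `<=` [set t | U (pt t)]); last first.
  by rewrite (_ : [set t | _] = set0)//; apply/seteqP; split=> t // [].
rewrite (_ : [set t | _] = row_box p.1 p.2); last first.
  by apply/seteqP; split=> t // [].
pose A i : set (measurableTypeR R) := [set x | `|x - ratr (tnth p.1 i)| < p.2.+1%:R^-1].
apply: (@measurable_tuple_forall A) => i; rewrite /A.
set q : R := ratr _; set r : R := _^-1.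
rewrite (_ : [set _ | _] = `]q - r, q + r[%classic); first exact: measurable_itv.
by apply/seteqP; split=> x; rewrite /= in_itv /= ltr_distl.
Qed.

Lemma measurable_continuous_pt (g : 'rV[R]_d -> R) :
  continuous g -> measurable_fun setT (g \o pt).
Proof.
move=> cg; apply: (measurability _ (RGenOpens.measurableE R)).
move=> _ [_ [a [b ->] <-]]; rewrite setTI.
by apply: (@measurable_pt_open (g @^-1` `]a, b[)); apply: open_comp.
Qed.

End lebesgue_on_row_vectors.

(** * Cubes and their finite measure *)

Definition cube {R : realType} d (M : R) : set (d.-tuple (measurableTypeR R)) :=
  [set t | forall i, `|tnth t i| <= M].
Arguments cube {R} d M.

Lemma measurable_cube {R : realType} d (M : R) : measurable (cube d M).
Proof.
pose A (_ : 'I_d) : set (measurableTypeR R) := [set x | `|x| <= M].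
apply: (@measurable_tuple_forall _ _ A) => i; rewrite /A.
rewrite (_ : [set _ | _] = `[- M, M]%classic); first exact: measurable_itv.
by apply/seteqP; split=> x; rewrite /= in_itv /= ler_norml.
Qed.

(** The norm on row vectors is the maximum norm. *)
Lemma cube_norm_pt {R : realType} d (M : R) t : `|pt t| <= M -> cube d M t.
Proof.
move=> tM i; apply: le_trans tM; rewrite -[`|pt t|]/(mx_norm _) mx_normrE.
by apply: le_trans (le_bigmax _ _ (ord0, i)); rewrite mxE.
Qed.

Lemma leb_cube_lty {R : realType} d (M : R) : (leb d (cube d M) < +oo)%E.
Proof.
elim: d => [|d IH] /=; first by rewrite diracE; case: (_ \in _); rewrite ltry.
rewrite /cons_measure /pushforward.
have -> : @tuple_cons R d @^-1` cube d.+1 M = `[- M, M]%classic `*` cube d M.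
  apply/seteqP; split=> [[x t]|[x t] [/= xM tM] i] /=.
    move=> H; split => /=.
      by have := H ord0; rewrite tnth0 in_itv /= -ler_norml.
    by move=> i; have := H (lift ord0 i); rewrite tnthS.
  case: (unliftP ord0 i) => [j|] ->; first by rewrite tnthS.
  by rewrite tnth0 ler_norml; move: xM; rewrite in_itv.
rewrite product_measure1E//; last exact: measurable_cube.
apply: lte_mul_pinfty => //.
have fin : (lebesgue_measure (`[- M, M]%classic : set R) : \bar R) \is a fin_num.
  by rewrite lebesgue_measure_itv; case: ifP.
exact: fin.
Qed.

(** * Continuous functions of compact support *)

Section compact_support.
Context {R : realType} {d : nat} (Omega : set 'rV[R]_d).
Hypothesis mO : measurable [set t : d.-tuple (measurableTypeR R) | Omega (pt t)].
Variables (g : 'rV[R]_d -> R) (K : set 'rV[R]_d).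
Hypotheses (cg : continuous g) (cK : compact K) (gK : forall x, ~ K x -> g x = 0).

Lemma compact_support_cube : exists2 M : R, 0 < M &
  forall t, ~ cube d M t -> g (pt t) = 0.
Proof.
have [M [_ MK]] := compact_bounded cK.
(* Boundedness of [K] supplies a bound only for numbers strictly above [M], hence the added 1. *)
exists (`|M| + 1) => [|t ntM]; first by rewrite ltr_pwDr.
apply: gK => Kt; apply: ntM; apply: cube_norm_pt.
exact: MK (le_lt_trans (ler_norm M) (ltr_pwDr ltr01 (lexx _))) _ Kt.
Qed.

Lemma compact_support_bounded : exists B : R, forall x, `|g x| <= B.
Proof.
have [|B [_ BK]] := compact_bounded (continuous_compact _ cK : compact (g @` K)).
  exact: continuous_subspaceT.
exists (`|B| + 1) => x; have [Kx|nKx] := pselect (K x); last first.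
  by rewrite gK// normr0 addr_ge0.
apply: (BK (`|B| + 1)); last by exists x.
by rewrite (le_lt_trans (ler_norm B))// ltrDl.
Qed.

(** The square is bounded and vanishes off a cube of finite measure, hence is integrable on the
    whole space and on [Omega]. *)
Lemma compact_support_L2 : L2 Omega g.
Proof.
split; first exact: measurable_funTS (measurable_continuous_pt cg).
have [M M0 gM] := compact_support_cube; have [B gB] := compact_support_bounded.
have mC := @measurable_cube R d M.
apply: (@integrableS _ _ _ _ setT) => //.
rewrite (_ : (fun _ => _) = (fun t => (g (pt t) ^+ 2)%:E) \_ (cube d M)); last first.
  apply/funext => t; rewrite patchE; case: ifPn => // /negP tM.
  by rewrite gM ?expr0n// => tM'; apply: tM; rewrite inE.
apply: (integrable_mkcond _ mC).1.
apply: (@measurable_bounded_integrable _ _ _ _ (fun t => g (pt t) ^+ 2)) => //=.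
- exact: leb_cube_lty.
- apply: measurable_funTS; apply: measurable_funX.
  exact: measurable_continuous_pt.
- exists (B ^+ 2); split; first exact: num_real.
  move=> b Bb t _; apply: le_trans (ltW Bb).
  by rewrite normrX ler_pXn2r ?nnegrE// (le_trans _ (gB 0)).
Qed.

End compact_support.

(** * Linear combinations and supports of test functions *)

Section test_functions.
Context {R : realType} {d : nat}.
Implicit Types (phi psi : 'rV[R]_d -> R) (K Omega : set 'rV[R]_d).

Definition smooth phi := forall s, continuous (partial s phi) /\
  forall i x, derivable (partial s phi) x (delta_mx 0 i).

Lemma partial_lin (a : R) phi psi s : smooth phi -> smooth psi ->
  partial s (fun x => a * phi x + psi x) =
  (fun x => a * partial s phi x + partial s psi x).
Proof.
move=> sphi spsi; elim: s => [//|i s IH] /=; rewrite IH; apply/funext => x.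
have [_ dphi] := sphi s; have [_ dpsi] := spsi s.
have := deriveD (derivableZ (k := a) (dphi i x)) (dpsi i x).
by rewrite deriveZ.
Qed.

Lemma smooth_lin (a : R) phi psi : smooth phi -> smooth psi ->
  smooth (fun x => a * phi x + psi x).
Proof.
move=> sphi spsi s; rewrite partial_lin//.
have [cphi dphi] := sphi s; have [cpsi dpsi] := spsi s; split.
  by move=> x; exact: (cvgD (cvgM (cvg_cst a) (cphi x)) (cpsi x)).
by move=> i x; exact: (derivableD (derivableZ (k := a) (dphi i x)) (dpsi i x)).
Qed.

(** The complement of a compact set is open, so near such a point the function differentiated is
    constantly 0, and this passes from each derivative to the next. *)
Lemma partial_off_support phi K s : smooth phi -> compact K ->
  (forall x, ~ K x -> phi x = 0) -> forall x, ~ K x -> partial s phi x = 0.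
Proof.
move=> sphi cK phiK; elim: s => [|i s IH] x nKx /=; first exact: phiK.
have /closed_openC oK : closed K by apply: compact_closed cK; exact: norm_hausdorff.
rewrite (@near_eq_derive _ _ _ _ (cst 0)) ?derive_cst//.
have := open_nbhs_nbhs (conj oK nKx).
by apply: filterS => y; exact: IH.
Qed.

Lemma test_function_lin Omega (a : R) phi psi :
  test_function Omega phi -> test_function Omega psi ->
  test_function Omega (fun x => a * phi x + psi x).
Proof.
move=> [sphi [K [cK KO phiK]]] [spsi [L [cL LO psiL]]].
split; first exact: (smooth_lin a sphi spsi).
exists (K `|` L); split; first exact: compactU.
  by rewrite subUset.
by move=> x /not_orP[nKx nLx]; rewrite phiK// psiL// mulr0 addr0.
Qed.

Lemma partial_0 s : partial s (fun=> 0 : R) = (fun=> 0 : R) :> ('rV[R]_d -> R).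
Proof.
elim: s => [//|i s IH] /=; rewrite IH.
by apply/funext => x; rewrite derive_cst.
Qed.

Lemma test_function_0 Omega : test_function Omega (fun=> 0).
Proof.
split; last by exists set0; split => //; exact: compact0.
move=> s; rewrite partial_0; split; first exact: cst_continuous.
by move=> i x; exact: derivable_cst.
Qed.

Lemma of_test_lin (a : R) phi psi : smooth phi -> smooth psi ->
  of_test (fun x => a * phi x + psi x) = a *: of_test phi + of_test psi.
Proof.
move=> sphi spsi; apply: (@injective_projections _ _ (of_test _)); first by [].
by apply/funext => i; rewrite h1fun_lin2 -[LHS]/(partial [:: i] _) partial_lin.
Qed.

Lemma of_test_0 : of_test (fun=> 0 : R) = (0 : h1fun R d).
Proof.
apply: (@injective_projections _ _ (of_test _)); first by [].
by apply/funext => i; rewrite -[LHS]/(partial [:: i] _) partial_0.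
Qed.

End test_functions.

(** * Linearity of H^1_0 and of the finite element spaces *)

Section sobolev_subspace.
Context {R : realType} {d : nat} (Omega : set 'rV[R]_d).
Hypothesis mO : measurable [set t : d.-tuple (measurableTypeR R) | Omega (pt t)].
Local Notation V := (H10 Omega).
Local Notation norm1 := (h1norm Omega).

Lemma of_test_integrable phi : test_function Omega phi -> integrable_h1 Omega (of_test phi).
Proof.
move=> [sphi [K [cK _ phiK]]]; split=> [|i].
  by apply: (@compact_support_L2 _ _ _ mO _ K) => //; exact: (sphi [::]).1.
apply: (@compact_support_L2 _ _ _ mO _ K) => //; first exact: (sphi [:: i]).1.
exact: (@partial_off_support _ _ phi K [:: i]).
Qed.

Lemma H10_integrable v : V v -> integrable_h1 Omega v.
Proof. by case. Qed.

(** The same linear combination of the two approximating sequences converges, by the triangle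
    inequality for [h1norm]. *)
Lemma H10_lin : lin_closed V.
Proof.
move=> a v w [Lv Lv' [phi [tphi cphi]]] [Lw Lw' [psi [tpsi cpsi]]].
have Hv : integrable_h1 Omega v by [].
have Hw : integrable_h1 Omega w by [].
have HL := integrable_h1_lin mO; have H0 := integrable_h1_0 mO.
have HI := semi_inner_h1 mO.
have [L L'] := HL a _ _ Hv Hw.
split => //; exists (fun n x => a * phi n x + psi n x); split.
  by move=> n; exact: test_function_lin.
have cvg0 : `|a| * norm1 (v - of_test (phi n)) + norm1 (w - of_test (psi n))
    @[n --> \oo] --> (0 : R).
  by rewrite -[0]addr0 -[X in X + _](mulr0 `|a|); apply: cvgD => //; exact: cvgM (cvg_cst _) cphi.
apply: (squeeze_cvgr _ (cvg_cst 0) cvg0); apply: nearW => n.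
rewrite sqrtr_ge0 /= of_test_lin; [|exact: (tphi n).1|exact: (tpsi n).1].
have Hp := of_test_integrable (tphi n); have Hq := of_test_integrable (tpsi n).
have Hvp := lin_closedB HL Hv Hp; have Hwq := lin_closedB HL Hw Hq.
have -> : a *: v + w - (a *: of_test (phi n) + of_test (psi n)) =
   a *: (v - of_test (phi n)) + (w - of_test (psi n)).
  by rewrite scalerBr opprD addrACA.
apply: le_trans (semi_normD HL HI (lin_closedZ H0 HL a Hvp) Hwq) _.
by rewrite (semi_normZ H0 HL HI).
Qed.

Lemma H10_0 : V 0.
Proof.
have [L L'] := integrable_h1_0 mO; split => //; exists (fun _ _ => 0); split.
  by move=> n; exact: test_function_0.
rewrite of_test_0 subrr.
have -> : norm1 0 = 0.
  exact: (semi_norm0 (integrable_h1_0 mO) (integrable_h1_lin mO) (semi_inner_h1 mO)).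
exact: cvg_cst.
Qed.

Lemma affine_on_lin (a : R) (A : set 'rV[R]_d) g h : affine_on A g -> affine_on A h ->
  affine_on A (fun x => a * g x + h x).
Proof.
move=> [p [b gE]] [q [c hE]]; exists (a *: p + q), (a * b + c) => x Ax.
by rewrite gE// hE// mulmxDr -scalemxAr !mxE; ring.
Qed.

Lemma fe_space_lin T : lin_closed (fe_space Omega T).
Proof.
move=> a v w [Vv cv av] [Vw cw aw]; split; first exact: H10_lin.
  rewrite h1fun_lin1 => x.
  by exact: (cvgD (cvgM (cvg_cst a) (cv x)) (cw x)).
by move=> K TK; rewrite h1fun_lin1; apply: affine_on_lin; [exact: av|exact: aw].
Qed.

Lemma fe_space_0 T : fe_space Omega T 0.
Proof.
split; first exact: H10_0.
  by move=> x; exact: cvg_cst.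
by move=> K TK; exists 0, 0 => x _; rewrite mulmx0 mxE addr0.
Qed.

End sobolev_subspace.

(** * The Poincare inequality on a line *)

Section poincare_line.
Context {R : realType}.
Local Notation mu := (@lebesgue_measure R).
Variables (g g' : R -> R) (M : R).
Hypotheses (M0 : 0 < M) (dg : forall x : R, is_derive x 1 g (g' x)) (cg' : continuous g').
Hypothesis g0 : forall x, M <= `|x| -> g x = 0.

Let cg : continuous g.
Proof.
by move=> x; apply: differentiable_continuous; apply/derivable1_diffP; case: (dg x).
Qed.

Let I : set (measurableTypeR R) := `[- M, M]%classic.

Let mI : measurable I.
Proof. exact: measurable_itv. Qed.

Let integrable_cont (h : R -> R) : continuous h -> mu.-integrable I (EFin \o h).
Proof.
move=> ch; apply: continuous_compact_integrable; first exact: segment_compact.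
exact: continuous_subspaceT.
Qed.

Let cM (h k : R -> R) : continuous h -> continuous k -> continuous (fun x => h x * k x).
Proof. by move=> ch ck x; exact: (cvgM (ch x) (ck x)). Qed.

Let c2xgg' : continuous (fun x : R => 2 * x * g x * g' x).
Proof.
have c2 : continuous (fun _ : R => 2 : R) by exact: cst_continuous.
have cid : continuous (fun x : R => x) by move=> x; exact: cvg_id.
exact: cM (cM (cM c2 cid) cg) cg'.
Qed.

(* The integral of [(x * g x ^ 2)'] vanishes. *)
Lemma integral_sqr_by_parts :
  \int[mu]_(x in I) (g x * g x) + \int[mu]_(x in I) (2 * x * g x * g' x) = 0.
Proof.
have igg := integrable_cont (cM cg cg).
rewrite -RintegralD//; last exact: integrable_cont c2xgg'.
pose F (x : R) : R := x * (g x * g x).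
have dF (x : R) : is_derive x 1 F (g x * g x + 2 * x * g x * g' x).
  have d1 : is_derive x 1 (id * (g * g)) (x *: (g x *: g' x + g x *: g' x) + (g x * g x) *: 1).
    exact: is_deriveM.
  apply: is_derive_eq d1 _; rewrite /GRing.scale /=; ring.
have cF : continuous F.
  move=> x; apply: differentiable_continuous; apply/derivable1_diffP.
  by case: (dF x).
rewrite /Rintegral (@continuous_FTC2 _ _ F).
- have gM : g M = 0 by rewrite g0// ger0_norm// ltW.
  have gNM : g (- M) = 0 by rewrite g0// normrN ger0_norm// ltW.
  by rewrite /F gM gNM !mulr0 subee.
- by rewrite -subr_gt0 opprK addr_gt0.
- apply: continuous_subspaceT => x.
  exact: (cvgD (@cM _ _ cg cg x) (@c2xgg' x)).
- split.
  + by move=> x _; case: (dF x).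
  + exact/cvg_at_right_filter/cF.
  + exact/cvg_at_left_filter/cF.
- by move=> x _; rewrite derive1E; case: (dF x).
Qed.

Lemma poincare_segment :
  \int[mu]_(x in I) (g x * g x) <= 4 * M ^+ 2 * \int[mu]_(x in I) (g' x * g' x).
Proof.
have igg := integrable_cont (cM cg cg).
have ig' := integrable_cont (cM cg' cg').
have ixg := integrable_cont c2xgg'.
(* Expanding [0 <= (g + 2 x g') ^ 2] and using [x ^ 2 <= M ^ 2] gives the pointwise bound. Since the
   right side integrates to minus the integral of [g ^ 2], half of that integral is absorbed, whence
   the factor [4 * M ^+ 2]. *)
have H : \int[mu]_(x in I) (- 2^-1 * (g x * g x) + - (2 * M ^+ 2) * (g' x * g' x)) <=
    \int[mu]_(x in I) (2 * x * g x * g' x).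
  apply: le_Rintegral => //.
    apply: integrable_cont => x.
    exact: (cvgD (@cM _ _ (@cst_continuous _ _ _) (cM cg cg) x)
                 (@cM _ _ (@cst_continuous _ _ _) (cM cg' cg') x)).
  move=> x; rewrite /I /= in_itv /= -ler_norml => xM.
  have : x ^+ 2 <= M ^+ 2 by rewrite -real_normK ?num_real// ler_pXn2r ?nnegrE// ltW.
  move=> /(ler_wpM2r (sqr_ge0 (g' x))).
  have := sqr_ge0 (g x + 2 * x * g' x); lra.
rewrite RintegralD// ?RintegralZl// in H; first last.
- exact: (integrable_cont (cM (@cst_continuous _ _ _) (cM cg' cg'))).
- exact: (integrable_cont (cM (@cst_continuous _ _ _) (cM cg cg))).
have {igg ig' ixg} := integral_sqr_by_parts; move: H.
by move: (Rintegral _ _ _) (Rintegral _ _ _) (Rintegral _ _ _) => a b r; lra.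
Qed.

(** The form used under Tonelli: extended-real integrals over the whole line. The left one reduces
    to the segment because [g] vanishes outside; the right one only grows when the segment is
    enlarged. *)
Lemma poincare_line :
  (\int[mu]_x (g x ^+ 2)%:E <= (4 * M ^+ 2)%:E * \int[mu]_x (g' x ^+ 2)%:E)%E.
Proof.
have igg := integrable_cont (cM cg cg).
have ig' := integrable_cont (cM cg' cg').
have mg' : measurable_fun setT (fun x => (g' x ^+ 2)%:E).
  apply/measurable_EFinP; apply: continuous_measurable_fun => x.
  exact: (cM cg' cg').
have -> : (\int[mu]_x (g x ^+ 2)%:E = \int[mu]_(x in I) (g x * g x)%:E)%E.
  rewrite [RHS]integral_mkcond; apply: eq_integral => x _.
  rewrite patchE; case: ifPn => [_|xI]; first by rewrite expr2.
  rewrite g0 ?expr0n//; apply: contraNT xI; rewrite -ltNge => xM.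
  by rewrite inE /I /= in_itv /= -ler_norml ltW.
apply: (@le_trans _ _ ((4 * M ^+ 2)%:E * \int[mu]_(x in I) (g' x * g' x)%:E)%E).
  rewrite -[leLHS]fineK; last exact: integrable_fin_num igg.
  rewrite -[X in (_ * X)%E]fineK; last exact: integrable_fin_num ig'.
  by rewrite -EFinM lee_fin poincare_segment.
apply: lee_wpmul2l; first by rewrite lee_fin mulr_ge0// sqr_ge0.
by apply: ge0_subset_integral => // x _; rewrite lee_fin sqr_ge0.
Qed.

End poincare_line.

(** * From lines to the whole space by Tonelli *)

Section poincare_space.
Context {R : realType} {d : nat}.
Implicit Types (phi : 'rV[R]_d.+1 -> R) (t : d.-tuple (measurableTypeR R)).

(** A change of the first coordinate is a translation along the first basis vector; this identifies
    the partial derivative with a derivative in one variable. *)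
Lemma pt_tuple_cons (x y : R) t :
  pt (tuple_cons (x + y, t)) = x *: delta_mx 0 0 + pt (tuple_cons (y, t)).
Proof.
apply/rowP => i; rewrite !mxE; case: (unliftP ord0 i) => [j|] ->.
  by rewrite !tnthS /= mulr0 add0r.
by rewrite !tnth0 eqxx mulr1.
Qed.

Lemma continuous_line phi t : continuous phi ->
  continuous (fun x : R => phi (pt (tuple_cons (x, t)))).
Proof.
move=> cphi x; apply: continuous_comp; last exact: cphi.
rewrite (_ : (fun _ => _) = (fun y : R => y *: delta_mx 0 0 + pt (tuple_cons (0 : R, t)))).
  by apply: cvgD; [exact: cvgZ cvg_id (cvg_cst _)|exact: cvg_cst].
by apply/funext => y; rewrite -pt_tuple_cons addr0.
Qed.

Lemma is_derive_line phi t (x : R) : smooth phi ->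
  is_derive x 1 (fun x : R => phi (pt (tuple_cons (x, t))))
    (partial [:: ord0] phi (pt (tuple_cons (x, t)))).
Proof.
move=> sphi; have dphi := (sphi [::]).2 ord0 (pt (tuple_cons (x, t))).
have E : (fun h : R => h^-1 *: (((fun x : R => phi (pt (tuple_cons (x, t)))) \o shift x) (h *: 1) -
      phi (pt (tuple_cons (x, t))))) =
    (fun h : R => h^-1 *: ((phi \o shift (pt (tuple_cons (x, t)))) (h *: delta_mx 0 ord0) -
      phi (pt (tuple_cons (x, t))))).
  apply/funext => h /=.
  by rewrite -pt_tuple_cons /GRing.scale /= mulr1.
split; first by rewrite /derivable E.
by rewrite /derive E.
Qed.

(** The first coordinate is integrated innermost, and [poincare_line] bounds each inner integral.
    All integrands are nonnegative, so Tonelli applies without prior integrability. *)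
Lemma poincare_tuple phi (M : R) : 0 < M -> smooth phi ->
  (forall t : d.+1.-tuple (measurableTypeR R), ~ cube d.+1 M t -> phi (pt t) = 0) ->
  (\int[leb d.+1]_t (phi (pt t) ^+ 2)%:E <=
   (4 * (M + 1) ^+ 2)%:E * \int[leb d.+1]_t (partial [:: ord0] phi (pt t) ^+ 2)%:E)%E.
Proof.
move=> M0 sphi phiM.
have msqr (g : 'rV[R]_d.+1 -> R) : continuous g ->
    measurable_fun setT (fun t : d.+1.-tuple (measurableTypeR R) => (g (pt t) ^+ 2)%:E).
  move=> cg; apply/measurable_EFinP; apply: measurable_funX.
  exact: measurable_continuous_pt.
have fub (g : 'rV[R]_d.+1 -> R) : continuous g ->
    (\int[leb d.+1]_t (g (pt t) ^+ 2)%:E =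
     \int[leb d]_t \int[@lebesgue_measure R]_x (g (pt (tuple_cons (x, t))) ^+ 2)%:E)%E.
  move=> cg; rewrite /= /cons_measure (ge0_integral_pushforward (@measurable_tuple_cons R d))//;
    first last.
  - by move=> t _; rewrite lee_fin sqr_ge0.
  - exact: (msqr _ cg).
  rewrite preimage_setT fubini_tonelli2//.
  - exact: measurableT_comp (msqr _ cg) (@measurable_tuple_cons R d).
  - by move=> p; rewrite /= lee_fin sqr_ge0.
have mfub (g : 'rV[R]_d.+1 -> R) : continuous g ->
    measurable_fun setT
      (fun t => \int[@lebesgue_measure R]_x (g (pt (tuple_cons (x, t))) ^+ 2)%:E)%E.
  move=> cg; apply: (measurable_fun_fubini_tonelli_G
    (fun p : measurableTypeR R * d.-tuple (measurableTypeR R) => (g (pt (tuple_cons p)) ^+ 2)%:E)).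
  - exact: measurableT_comp (msqr _ cg) (@measurable_tuple_cons R d).
  - by move=> p; rewrite /= lee_fin sqr_ge0.
have c0 := (sphi [::]).1; have c1 := (sphi [:: ord0]).1.
have i0 (g : 'rV[R]_d.+1 -> R) t :
    (0 <= \int[@lebesgue_measure R]_x (g (pt (tuple_cons (x, t))) ^+ 2)%:E)%E.
  by apply: integral_ge0 => x _; rewrite lee_fin sqr_ge0.
rewrite (fub _ c0) (fub _ c1) -ge0_integralZl//; first last.
- by rewrite lee_fin mulr_ge0// sqr_ge0.
- exact: mfub.
apply: ge0_le_integral => //.
- exact: mfub.
- by apply: measurable_funeM; exact: mfub.
move=> t _; apply: poincare_line.
- by rewrite addr_gt0.
- by move=> x; exact: is_derive_line.
- exact: continuous_line.
(* [poincare_line] asks for vanishing already at the ends of the segment, while [phi] is known to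
   vanish only strictly outside the cube; hence [M + 1]. *)
- move=> x Mx; apply: phiM => /(_ ord0); rewrite tnth0 => xM.
  by have := le_trans Mx xM; rewrite gerDl ler10.
Qed.

End poincare_space.

(** * The Poincare inequality on H^1_0 of a bounded set *)

Section poincare.
Context {R : realType} {d : nat} (Omega : set 'rV[R]_d.+1).
Hypothesis mO : measurable [set t : d.+1.-tuple (measurableTypeR R) | Omega (pt t)].
Hypothesis bO : bounded_set Omega.

(** All derivatives of a test function vanish off [Omega], so integrals over [Omega] are integrals
    over the whole space, and a cube containing [Omega] serves in [poincare_tuple]. *)
Lemma poincare_test : exists2 D : R, 0 < D & forall phi, test_function Omega phi ->
  l2norm Omega (of_test phi) <= D * Num.sqrt (grad_form Omega (of_test phi) (of_test phi)).
Proof.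
have [M0 [_ MO]] := bO; pose M := `|M0| + 1.
have M_gt0 : 0 < M by rewrite ltr_pwDr.
exists (2 * (M + 1)) => [|phi tphi]; first by rewrite mulr_gt0// addr_gt0.
have [sphi [K [cK KO phiK]]] := tphi.
have zero s x : ~ Omega x -> partial s phi x = 0.
  by move=> nOx; apply: (partial_off_support s sphi cK phiK) => /KO.
have phiM t : ~ cube d.+1 M t -> phi (pt t) = 0.
  move=> ntM; apply: (zero [::]) => Ot; apply: ntM; apply: cube_norm_pt.
  exact: MO (le_lt_trans (ler_norm M0) (ltr_pwDr ltr01 (lexx _))) _ Ot.
have full s : (\int[leb d.+1]_t (partial s phi (pt t) ^+ 2)%:E =
    \int[leb d.+1]_(t in [set t | Omega (pt t)]) (partial s phi (pt t) ^+ 2)%:E)%E.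
  rewrite [RHS]integral_mkcond; apply: eq_integral => t _; rewrite patchE.
  case: ifPn => // /negP tO; rewrite zero ?expr0n// => Ot; apply: tO.
  by rewrite inE.
have [L0 L1] := of_test_integrable mO tphi.
have := poincare_tuple M_gt0 sphi phiM.
rewrite (full [::]) (full [:: ord0]).
have [_ i0] := L0; have [_ i1] := L1 ord0.
rewrite -[X in (X <= _)%E]fineK; last exact: (integrable_fin_num mO i0).
rewrite -[X in (_ * X)%E]fineK; last exact: (integrable_fin_num mO i1).
rewrite -EFinM lee_fin => P.
have g0 : 0 <= grad_form Omega (of_test phi) (of_test phi).
  by have [_ _] := semi_inner_grad mO; apply.
rewrite -[2 * (M + 1)]ger0_norm; last by rewrite mulr_ge0// addr_ge0// ltW.
rewrite -sqrtr_sqr -sqrtrM ?sqr_ge0// ler_wsqrtr//.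
have -> : b_form Omega (of_test phi) (of_test phi) =
    fine (\int[leb d.+1]_(t in [set t | Omega (pt t)]) (phi (pt t) ^+ 2)%:E)%E.
  by rewrite /b_form /integ /Rintegral; under eq_integral do rewrite -expr2.
apply: (le_trans P); rewrite exprMn -[2 ^+ 2]/(2 * 2) -natrM.
apply: ler_wpM2l; first by rewrite mulr_ge0// sqr_ge0.
(* The squared first partial derivative is one of the nonnegative terms of the squared gradient. *)
apply: le_Rintegral => //.
  exact: grad_dot_integrable.
move=> t _; rewrite /grad_dot (bigD1 ord0)//= expr2 lerDl sumr_ge0// => i _.
by rewrite -expr2 sqr_ge0.
Qed.

(** Passing from [v] to a test function and back costs [1 + D] times their H^1 distance, which tends
    to 0. Adding the gradient part to the squared L^2 bound gives [D ^+ 2 + 1]. *)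
Lemma poincare : exists2 D : R, 0 < D & forall v, H10 Omega v ->
  h1norm Omega v ^+ 2 <= D * grad_form Omega v v.
Proof.
have [D D0 DP] := poincare_test; exists (D ^+ 2 + 1) => [|v [Lv Lv' [phi [tphi cphi]]]].
  by rewrite ltr_wpDl// sqr_ge0.
have Hv : integrable_h1 Omega v by [].
have HL := integrable_h1_lin mO.
have bI := semi_inner_b mO; have gI := semi_inner_grad mO.
have b0 := semi_inner_ge0 bI; have g0 := semi_inner_ge0 gI.
set g := Num.sqrt (grad_form Omega v v).
have le_n n : l2norm Omega v <= D * g + (1 + D) * h1norm Omega (v - of_test (phi n)).
  have Hp := of_test_integrable mO (tphi n); have Hvp := lin_closedB HL Hv Hp.
  set e := h1norm _ _.
  have le0 : l2norm Omega (v - of_test (phi n)) <= e by exact: l2norm_le_h1norm.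
  have leg : Num.sqrt (grad_form Omega (of_test (phi n) - v) (of_test (phi n) - v)) <= e.
    by rewrite (semi_norm_sub (integrable_h1_0 mO) HL gI)// ler_wsqrtr// lerDr.
  have tb := semi_normD HL bI Hvp Hp; rewrite subrK in tb.
  have tg := semi_normD HL gI (lin_closedB HL Hp Hv) Hv; rewrite subrK in tg.
  have := DP _ (tphi n).
  have := ler_wpM2l (ltW D0) (le_trans tg (lerD leg (lexx _))).
  move: tb le0; rewrite -!/(l2norm _ _) -/g; lra.
have le : l2norm Omega v <= D * g.
  have cv : D * g + (1 + D) * h1norm Omega (v - of_test (phi n)) @[n --> \oo] --> D * g.
    rewrite -[X in _ --> X]addr0 -[X in _ --> _ + X](mulr0 (1 + D)).
    exact: (cvgD (cvg_cst _) (cvgM (cvg_cst _) cphi)).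
  by apply: (cvgr_to_ge cv); exact: nearW.
rewrite sqr_sqrtr ?addr_ge0// mulrDl mul1r lerD2r.
rewrite -[leLHS]sqr_sqrtr// -[X in _ * X]sqr_sqrtr// -exprMn.
by rewrite ler_pXn2r ?nnegrE ?mulr_ge0 ?sqrtr_ge0// ltW.
Qed.

End poincare.

(** * Best approximation errors *)

Section best_approximation.
Context {R : realType} {d : nat} (Omega : set 'rV[R]_d).
Implicit Types (W : set (h1fun R d)) (v w : h1fun R d).

Let has_lb W v : has_lbound [set h1norm Omega (v - w) | w in W].
Proof. by exists 0 => _ [w _ <-]; exact: sqrtr_ge0. Qed.

Lemma best_approx_le W v w : W w -> best_approx Omega W v <= h1norm Omega (v - w).
Proof. by move=> Ww; apply: ge_inf => //; exists w. Qed.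

Lemma best_approx_ge0 W v : W 0 -> 0 <= best_approx Omega W v.
Proof.
move=> W0; apply: lb_le_inf; first by exists (h1norm Omega (v - 0)); exists 0.
by move=> _ [w _ <-]; exact: sqrtr_ge0.
Qed.

(** [W 0] excludes the empty set, whose [inf] is 0 by convention. *)
Lemma best_approx_anti W W' v : W 0 -> W `<=` W' ->
  best_approx Omega W' v <= best_approx Omega W v.
Proof.
move=> W0 WW'; apply: lb_le_inf; first by exists (h1norm Omega (v - 0)); exists 0.
by move=> _ [w Ww <-]; apply: best_approx_le; exact: WW'.
Qed.

End best_approximation.

(** * The scalar error recurrence over the levels *)

Section multigrid_recurrence.
Context {R : realFieldType}.
Variables (K c beta etaH : R) (eta delta eps : nat -> R) (n : nat).
Hypotheses (K0 : 0 < K) (c0 : 0 < c) (beta1 : 1 < beta) (etaH0 : 0 <= etaH).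
Hypothesis (small : (2 * K * c + 2 * K * c ^+ 2) * beta ^+ 2 * etaH <= 1).
Hypotheses (eta0 : forall k, 0 <= eta k) (delta0 : forall k, 0 <= delta k).
Hypothesis etaleH : forall k, (1 <= k <= n)%N -> eta k <= etaH.
Hypothesis delta_step : forall k, (1 <= k < n)%N -> delta k <= c * beta * delta k.+1.
Hypothesis eps1 : eps 1%N = 0.
Hypothesis eps_step : forall k, (1 <= k < n)%N ->
  eps k.+1 <= K * (eta k * delta k + etaH * eps k).

Let beta0 : 0 < beta. Proof. exact: lt_trans beta1. Qed.

Lemma recurrence_small1 : 2 * K * c * beta * etaH <= 1.
Proof.
apply: le_trans small; apply: ler_wpM2r => //.
have : 0 <= K * c * beta * (beta - 1).
  by rewrite !mulr_ge0// ?subr_ge0 ltW.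
have : 0 <= K * c ^+ 2 * beta ^+ 2 by rewrite !mulr_ge0// ?sqr_ge0 ltW.
lra.
Qed.

Lemma recurrence_small2 : 2 * K * c ^+ 2 * beta ^+ 2 * etaH <= 1.
Proof.
apply: le_trans small; apply: ler_wpM2r => //.
have : 0 <= K * c * beta ^+ 2 by rewrite !mulr_ge0// ?sqr_ge0 ltW.
lra.
Qed.

(** By induction and smallness [eps k <= delta k], so both terms of the step are at most
    [etaH * delta k]; moving [delta] one level up costs [c * beta]. *)
Lemma recurrence_energy k : (1 <= k <= n)%N ->
  eps k <= 2 * K * c * beta * etaH * delta k.
Proof.
elim: k => [//|[_ _|k IH /andP[_ kn]]].
  by rewrite eps1 !mulr_ge0// ltW.
have kn' : (1 <= k.+1 < n)%N by [].
have IHk := IH (ltnW kn); apply: (le_trans (eps_step kn')).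
have e1 := ler_wpM2r (delta0 k.+1) (etaleH (ltnW kn : (1 <= k.+1 <= n)%N)).
have e2 : etaH * eps k.+1 <= etaH * delta k.+1.
  apply: ler_wpM2l => //; apply: (le_trans IHk); rewrite -[leRHS]mul1r.
  by apply: ler_wpM2r => //; exact: recurrence_small1.
have e3 := ler_wpM2l (mulr_ge0 (ltW K0) etaH0) (delta_step kn').
have := ler_wpM2l (ltW K0) (lerD e1 e2); lra.
Qed.

(** Here [eta k] is kept instead of being bounded by [etaH]. One level up costs [c * beta] for
    [delta] and again for [eta], which is the source of [beta ^+ 2] in the smallness condition. *)
Lemma recurrence_L2 k :
  (forall k, (1 <= k < n)%N -> eta k <= c * (beta * eta k.+1)) ->
  (1 <= k <= n)%N -> eps k <= 2 * K * c ^+ 2 * beta ^+ 2 * (eta k * delta k).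
Proof.
move=> eta_step; elim: k => [//|[_ _|k IH /andP[_ kn]]].
  by rewrite eps1 !mulr_ge0// ?sqr_ge0// ltW.
have kn' : (1 <= k.+1 < n)%N by [].
have IHk := IH (ltnW kn); apply: (le_trans (eps_step kn')).
have ed0 : 0 <= eta k.+1 * delta k.+1 by rewrite mulr_ge0.
have e2 : etaH * eps k.+1 <= eta k.+1 * delta k.+1.
  apply: (le_trans (ler_wpM2l etaH0 IHk)).
  by have := ler_wpM2r ed0 recurrence_small2; lra.
have e3 := ler_pM (eta0 _) (delta0 _) (eta_step _ kn') (delta_step kn').
have := ler_wpM2l (ltW K0) (lerD (lexx (eta k.+1 * delta k.+1)) e2).
have := ler_wpM2l (ltW K0) e3; lra.
Qed.

Lemma recurrence_energy_le k : (1 <= k <= n)%N -> eps k <= delta k.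
Proof.
move=> kn; apply: (le_trans (recurrence_energy kn)); rewrite -[leRHS]mul1r.
by apply: ler_wpM2r => //; exact: recurrence_small1.
Qed.

(** The product [etaH * eps k] is what A2 gives, up to [c], for the eigenvalue and L^2 errors
    against the direct solution. *)
Lemma recurrence_L2_le k :
  (forall k, (1 <= k < n)%N -> eta k <= c * (beta * eta k.+1)) ->
  (1 <= k <= n)%N -> etaH * eps k <= eta k * delta k.
Proof.
move=> eta_step kn; apply: (le_trans (ler_wpM2l etaH0 (recurrence_L2 eta_step kn))).
by have := ler_wpM2r (mulr_ge0 (eta0 k) (delta0 k)) recurrence_small2; lra.
Qed.

End multigrid_recurrence.

(** * Arithmetic of the constants *)

Section error_budget.
Context {R : realFieldType}.
Implicit Types c K p q r s l n : R.

Lemma correction_data_error c p q r l l1 l2 l3 n n1 n2 n3 :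
  l <= l1 + l2 + l3 -> n <= n1 + n2 + n3 -> l1 + n1 <= c ^+ 2 * p ->
  l2 + n2 <= c ^+ 2 * q -> l3 + n3 <= r -> p <= q -> l + n <= 2 * c ^+ 2 * q + r.
Proof. by move=> ? ? ? ? ? /(ler_wpM2l (sqr_ge0 c)); lra. Qed.

(** In the application [p] is [eta * delta] on the old level, [q] is the coarse [eta] times the old
    [eps], and [r] is the error of the data entering the auxiliary problem. *)
Lemma correction_constant c K p q r : 0 <= c -> 0 <= K -> 0 <= p -> 0 <= q ->
  r <= 2 * c ^+ 2 * p + c * q ->
  c * (K * r + c * p) <= c * (K * (2 * c ^+ 2 + c) + c) * (p + q).
Proof.
move=> c0 K0 p0 q0 /(ler_wpM2l K0) r_le; rewrite -mulrA ler_wpM2l//.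
have : 0 <= K * (2 * c ^+ 2) * q by rewrite !mulr_ge0// sqr_ge0.
have : 0 <= K * c * p by rewrite !mulr_ge0.
have : 0 <= c * q by rewrite mulr_ge0.
by lra.
Qed.

(** The energy bound needs [c + 1] and the L^2 bound [c ^+ 2 + c]; the sum [c ^+ 2 + c + 1] serves
    both. *)
Lemma energy_budget c p r s t : 0 <= p -> r <= s + t -> s <= c * p -> t <= p ->
  r <= (c ^+ 2 + c + 1) * p.
Proof. by move=> /(mulr_ge0 (sqr_ge0 c)); lra. Qed.

Lemma L2_budget c p q l l1 l2 n n1 n2 : 0 <= c -> 0 <= p ->
  l <= l1 + l2 -> n <= n1 + n2 -> l1 + n1 <= c ^+ 2 * p -> l2 + n2 <= c * q ->
  q <= p -> l + n <= (c ^+ 2 + c + 1) * p.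
Proof. by move=> c0 p0 ? ? ? ? /(ler_wpM2l c0); lra. Qed.

End error_budget.

(** * Consistency of the auxiliary linear problems *)

Section correction.
Context {R : realType} {d : nat}.
Variables (Omega : set 'rV[R]_d) (f : 'rV[R]_d -> R -> R).
Hypothesis oO : open Omega.
Hypothesis sf : smooth_enough Omega f.
Local Notation V := (H10 Omega).
Local Notation b := (b_form Omega).
Local Notation grad := (grad_form Omega).
Local Notation norm0 := (l2norm Omega).
Local Notation norm1 := (h1norm Omega).
Local Notation fe := (fe_space Omega).
Implicit Types (v w psi : h1fun R d).

Let mO := measurable_pt_open oO.
Let HL := integrable_h1_lin mO.
Let H0 := integrable_h1_0 mO.
Let bI := semi_inner_b mO.
Let gI := semi_inner_grad mO.
Let VI v : V v -> integrable_h1 Omega v. Proof. exact: H10_integrable. Qed.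

Lemma a_formE w psi : V w -> V psi -> a_form Omega f w psi = grad w psi + f_form Omega f w psi.
Proof.
move=> Vw Vp; have [_ _ _ fi] := sf.
rewrite /a_form /integ RintegralD//.
  exact: grad_dot_integrable (VI Vw) (VI Vp).
exact: fi.
Qed.

Lemma f_formB w v psi : V w -> V v -> V psi ->
  f_form Omega f w psi - f_form Omega f v psi =
  integ Omega (fun x => (f x (w.1 x) - f x (v.1 x)) * psi.1 x).
Proof.
move=> Vw Vv Vp; have [_ _ _ fi] := sf.
rewrite /f_form /integ -RintegralB//; [|exact: fi..].
by apply: eq_Rintegral => t _; rewrite mulrBl.
Qed.

Section residual.
Variables (c mu nu : R) (z w : h1fun R d).
Hypotheses (Vz : V z) (Vw : V w) (bw : b w w = 1).
Local Notation err := (`|mu - nu| + norm0 (z - w)).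

(** Here [(mu, z)] plays the direct solution and [(nu, w)] the current iterate. The difference
    splits into an eigenvalue part, where [w] has unit L^2 norm, and an eigenfunction part. *)
Lemma residual_mass v : V v ->
  `|mu * b z v - nu * b w v| <= (1 + `|mu|) * err * norm1 v.
Proof.
move=> Vv; have [Hz Hw Hv] := And3 (VI Vz) (VI Vw) (VI Vv).
have -> : mu * b z v - nu * b w v = (mu - nu) * b w v + mu * b (z - w) v.
  by rewrite (semi_innerBl bI)//; ring.
have lv : norm0 v <= norm1 v by exact: l2norm_le_h1norm.
have cs1 : `|b w v| <= norm1 v.
  by apply: le_trans (cauchy_schwarz HL bI Hw Hv) _; rewrite bw sqrtr1 mul1r.
have cs2 : `|b (z - w) v| <= norm0 (z - w) * norm1 v.
  apply: le_trans (cauchy_schwarz HL bI (lin_closedB HL Hz Hw) Hv) _.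
  by apply: ler_wpM2l => //; exact: sqrtr_ge0.
apply: (le_trans (ler_normD _ _)); rewrite !normrM.
have := ler_wpM2l (normr_ge0 (mu - nu)) cs1.
have := ler_wpM2l (normr_ge0 mu) cs2.
have := mulr_ge0 (mulr_ge0 (normr_ge0 mu) (normr_ge0 (mu - nu)))
  (sqrtr_ge0 _ : 0 <= norm1 v).
have := mulr_ge0 (sqrtr_ge0 _ : 0 <= norm0 (z - w)) (sqrtr_ge0 _ : 0 <= norm1 v).
lra.
Qed.

Variables (T' : mesh R d) (D : R).
Hypotheses (c0 : 0 < c) (D0 : 0 < D).
Hypothesis poincareD : forall v, V v -> norm1 v ^+ 2 <= D * grad v v.
Hypothesis ez : is_eigenpair Omega f (fe T') mu z.

Let feV v : fe T' v -> V v. Proof. by case. Qed.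
Let err0 : 0 <= err. Proof. by rewrite addr_ge0// sqrtr_ge0. Qed.

Let coef0 : 0 <= 1 + `|mu| + c. Proof. by rewrite addr_ge0 ?addr_ge0// ltW. Qed.

(** The number [r] stands for the nonlinear part: a difference of [f] terms under (B), a
    linearization remainder under (C). *)
Let total_residual r v : `|r| <= c * (norm0 (z - w) * norm1 v) -> V v ->
  `|mu * b z v - nu * b w v - r| <= (1 + `|mu| + c) * err * norm1 v.
Proof.
move=> rle Vv; apply: (le_trans (ler_normB _ _)).
have := lerD (residual_mass Vv) rle.
have := mulr_ge0 (mulr_ge0 (ltW c0) (normr_ge0 (mu - nu)))
  (sqrtr_ge0 _ : 0 <= norm1 v).
lra.
Qed.

(** The difference [z - uh] is itself used as test function: its gradient form is the residual,
    which is linear in its norm, while Poincare makes the form quadratic from below. *)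
Lemma fixed_point_consistency uh : assumption_B Omega f c -> fe T' uh ->
  (forall v, fe T' v -> grad uh v = nu * b w v - f_form Omega f w v) ->
  norm1 (z - uh) <= D * ((1 + `|mu| + c) * err).
Proof.
move=> aB fuh uhE; have [fz _ zE] := ez.
have fv := lin_closedB (fe_space_lin mO (T := T')) fz fuh.
set v := z - uh in fv *; have Vv := feV fv.
have E : grad v v = mu * b z v - nu * b w v - (f_form Omega f z v - f_form Omega f w v).
  rewrite {1}/v (semi_innerBl gI (VI Vz) (VI (feV fuh)) (VI Vv)) uhE//.
  by rewrite -zE// a_formE//; ring.
have rb : `|f_form Omega f z v - f_form Omega f w v| <= c * (norm0 (z - w) * norm1 v).
  by rewrite f_formB//; exact: aB.
have := total_residual rb Vv; rewrite -E => gle.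
have := poincareD Vv.
have := ler_wpM2l (ltW D0) (le_trans (ler_norm _) gle).
(* One factor [norm1 v] is to be cancelled; when it is 0 the claim is the nonnegativity of the
   bound. *)
have [->|vn0] := eqVneq (norm1 v) 0.
  by move=> _ _; exact: mulr_ge0 (ltW D0) (mulr_ge0 coef0 err0).
have v0 : 0 < norm1 v by rewrite lt_def vn0 sqrtr_ge0.
move=> h1 h2; have := le_trans h2 h1.
by rewrite expr2 mulrA ler_pM2r// mulrA.
Qed.

(** The inf-sup condition reduces the claim to the residual of [z - w - eh] in the linearized
    problem at [w]. *)
Lemma newton_consistency eh : assumption_C Omega f c -> newton_stable Omega f c T' w ->
  fe T' w -> fe T' eh ->
  (forall v, fe T' v -> linearized_form Omega f w eh v =
     nu * b w v - grad w v - f_form Omega f w v) ->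
  norm1 (z - (w + eh)) <= c * ((1 + `|mu| + c) * err).
Proof.
move=> [fvi aC] [stab _] fw feh ehE; have [fz _ zE] := ez.
have SL := fe_space_lin mO (T := T').
have fzw := lin_closedB SL fz fw.
have fe1 := lin_closedB SL fzw feh.
have -> : z - (w + eh) = z - w - eh by rewrite opprD addrA.
(* The gradient terms of [w] cancel, and what remains of [f] is its linearization remainder at [w],
   the quantity bounded in (C). *)
have E v : fe T' v -> linearized_form Omega f w (z - w - eh) v =
   mu * b z v - nu * b w v - integ Omega (fun x => (f x (z.1 x) - f x (w.1 x)
       - f_v f x (w.1 x) * (z.1 x - w.1 x)) * v.1 x).
  move=> fv; have Vv := feV fv.
  have fvB p q : V p -> V q -> fv_form Omega f w (p - q) v =
      fv_form Omega f w p v - fv_form Omega f w q v.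
    move=> Vp Vq; rewrite /fv_form /integ -RintegralB//; [|exact: fvi..].
    by apply: eq_Rintegral => t _; rewrite -mulrBl -mulrBr.
  have lE : linearized_form Omega f w (z - w - eh) v =
      grad z v - grad w v + fv_form Omega f w (z - w) v - linearized_form Omega f w eh v.
    rewrite /linearized_form (fvB _ _ (feV fzw) (feV feh)).
    rewrite (semi_innerBl gI (VI (feV fzw)) (VI (feV feh)) (VI Vv)).
    by rewrite (semi_innerBl gI (VI Vz) (VI Vw) (VI Vv)); ring.
  have -> : integ Omega (fun x => (f x (z.1 x) - f x (w.1 x)
       - f_v f x (w.1 x) * (z.1 x - w.1 x)) * v.1 x) =
       f_form Omega f z v - f_form Omega f w v - fv_form Omega f w (z - w) v.
    rewrite f_formB// /fv_form /integ -RintegralB//.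
    - by apply: eq_Rintegral => t _; rewrite -mulrBl.
    - have [_ _ _ fi] := sf.
      have := integrableB mO (fi _ _ Vz Vv) (fi _ _ Vw Vv).
      by apply: eq_integrable => // t _ /=; rewrite -EFinB mulrBl.
    - exact: (fvi _ _ _ Vw (feV fzw) Vv).
  by rewrite lE ehE// -zE// a_formE//; ring.
apply: (le_trans (stab _ fe1)); apply: ler_wpM2l; first exact: ltW.
set S := (X in sup X).
have K0 := mulr_ge0 coef0 err0.
(* If every test function has norm 0, then [S] is empty and its [sup] is 0 by convention. *)
have [->|/set0P S0] := eqVneq S set0; first by rewrite sup0.
apply: ge_sup => // _ [v [fv vn0] <-].
have v0 : 0 < norm1 v by rewrite lt_def vn0 sqrtr_ge0.
rewrite ler_pdivrMr// E//; apply: (le_trans (ler_norm _)).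
exact: total_residual (aC _ _ _ Vz Vw (feV fv)) (feV fv).
Qed.

End residual.

End correction.

(** * The correction space *)

Section enriched.
Context {R : realType} {d : nat}.
Implicit Types (W X : set (h1fun R d)) (ut : h1fun R d).

Lemma enriched_subspace W ut : W 0 -> lin_closed W -> Defs.subspace (enriched W ut).
Proof.
move=> W0 WL; split; first by exists 0 => //; exists 0; rewrite scale0r addr0.
move=> a v w [v1 Wv1 [s ->]] [w1 Ww1 [t ->]].
exists (a *: v1 + w1); first exact: WL.
by exists (a * s + t); rewrite scalerDr scalerA scalerDl addrACA.
Qed.

Lemma sub_enriched W ut : W `<=` enriched W ut.
Proof. by move=> w Ww; exists w => //; exists 0; rewrite scale0r addr0. Qed.

Lemma enriched_mem W ut : W 0 -> enriched W ut ut.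
Proof. by move=> W0; exists 0 => //; exists 1; rewrite scale1r add0r. Qed.

Lemma enriched_sub W X ut : lin_closed X -> W `<=` X -> X ut -> enriched W ut `<=` X.
Proof.
move=> XL WX Xut v [w Ww [t ->]]; rewrite addrC; apply: XL => //; exact: WX.
Qed.

End enriched.

Definition correction_assumption {R : realType} {d : nat} (Omega : set 'rV[R]_d)
    (f : 'rV[R]_d -> R -> R) (c : R) (kind : correction) : Prop :=
  match kind with
  | FixedPoint => assumption_B Omega f c
  | Newton => assumption_C Omega f c
  end.

(** * One correction step, then the whole scheme *)

Section convergence.
Context {R : realType} {d : nat}.
Variables (Omega : set 'rV[R]_d) (f : 'rV[R]_d -> R -> R).
Variables (lambda : R) (u : h1fun R d).
Variables (F : set (mesh R d)) (lbar : mesh R d -> R) (ubar : mesh R d -> h1fun R d).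
Variables (eta : set (h1fun R d) -> R)
  (approximates : set (h1fun R d) -> R -> h1fun R d -> Prop) (c D : R) (kind : correction).
Hypothesis oO : open Omega.
Hypothesis sf : smooth_enough Omega f.
Local Notation V := (H10 Omega).
Local Notation norm0 := (l2norm Omega).
Local Notation norm1 := (h1norm Omega).
Local Notation fe := (fe_space Omega).
Local Notation delta W := (best_approx Omega W u).
Hypothesis eu : is_eigenpair Omega f V lambda u.
Hypothesis feF : fe_family Omega f F lbar ubar.
Hypothesis c0 : 0 < c.
Hypothesis A1 : assumption_A1 Omega lambda u F lbar ubar eta c.
Hypothesis A2 : assumption_A2 Omega f F lbar ubar eta approximates c.
Hypothesis AK : correction_assumption Omega f c kind.
Hypotheses (D0 : 0 < D) (poincareD : forall v, V v -> norm1 v ^+ 2 <= D * grad_form Omega v v).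

Let mO := measurable_pt_open oO.
Let HL := integrable_h1_lin mO.
Let H0 := integrable_h1_0 mO.
Let bI := semi_inner_b mO.
Let hI := semi_inner_h1 mO.
Let VI v : V v -> integrable_h1 Omega v. Proof. exact: H10_integrable. Qed.
Let feI T v : fe T v -> integrable_h1 Omega v. Proof. by case=> /VI. Qed.
Let uV : V u. Proof. by case: eu. Qed.
Let feL T := fe_space_lin mO (T := T).
Let fe0 T := fe_space_0 mO T.
Let ubarP T : F T -> is_eigenpair Omega f (fe T) (lbar T) (ubar T).
Proof. by case: feF => _ _ _ h FT; exact: (h T FT). Qed.
Let ubar_fe T : F T -> fe T (ubar T). Proof. by case/ubarP. Qed.
Let eta0 W : 0 <= eta W. Proof. by case: A1 => -[]. Qed.
Let delta0 T : 0 <= delta (fe T). Proof. exact: best_approx_ge0. Qed.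

(** A mesh-independent bound for the direct eigenvalues once [eta <= 1]: their error is then at most
    [c ^+ 2 * delta], and [delta <= norm1 u] since 0 is a competitor. *)
Definition eigenvalue_bound := `|lambda| + c ^+ 2 * norm1 u.

Lemma discrete_error T : F T ->
  `|lambda - lbar T| + norm0 (u - ubar T) <= c ^+ 2 * (eta (fe T) * delta (fe T)).
Proof.
move=> FT; have [_ /(_ T FT) [h1 h2]] := A1; apply: (le_trans h2).
by have := ler_wpM2l (ltW c0) (ler_wpM2l (eta0 (fe T)) h1); lra.
Qed.

Lemma lbar_bound T : F T -> eta (fe T) <= 1 -> `|lbar T| <= eigenvalue_bound.
Proof.
move=> FT eta1; have e := discrete_error FT.
have n0 : 0 <= norm0 (u - ubar T) by exact: sqrtr_ge0.
have du : delta (fe T) <= norm1 u by rewrite -[X in norm1 X]subr0; exact: best_approx_le.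
have ed : eta (fe T) * delta (fe T) <= norm1 u.
  apply: le_trans du; rewrite -[leRHS]mul1r; exact: ler_wpM2r.
have := ler_wpM2l (sqr_ge0 c) ed.
have := ler_normB lambda (lambda - lbar T); rewrite subKr /eigenvalue_bound; lra.
Qed.

(** The stability constant is [D] for fixed-point steps and [c] for Newton steps; [D + c] covers
    both. *)
Definition update_constant := (D + c) * (1 + eigenvalue_bound + c).

Let Lam0 : 0 <= eigenvalue_bound.
Proof. by rewrite addr_ge0// mulr_ge0 ?sqr_ge0 ?sqrtr_ge0. Qed.

Let coef0 : 0 <= 1 + eigenvalue_bound + c.
Proof. exact: addr_ge0 (addr_ge0 ler01 Lam0) (ltW c0). Qed.

Let K1_ge0 : 0 <= update_constant.
Proof. exact: mulr_ge0 (addr_ge0 (ltW D0) (ltW c0)) coef0. Qed.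

(** The triangle inequality through the exact solution of the auxiliary problem: a consistency error
    plus the algebraic error of the multigrid solver. *)
Lemma update_estimate T T' lk uk ut : F T' -> eta (fe T') <= 1 ->
  fe T' uk -> b_form Omega uk uk = 1 -> update Omega f u eta c kind T T' lk uk ut ->
  fe T' ut /\ norm1 (ubar T' - ut) <=
    update_constant * (`|lbar T' - lk| + norm0 (ubar T' - uk)) + c * (eta (fe T) * delta (fe T)).
Proof.
move=> FT' eta1 fuk buk upd.
have fub := ubar_fe FT'; have Vuk : V uk by case: fuk.
have Vub : V (ubar T') by case: fub.
have := lbar_bound FT' eta1; set err := `|_| + _ => Lle.
have err0 : 0 <= err by rewrite addr_ge0// sqrtr_ge0.
have coefle : (1 + `|lbar T'| + c) * err <= (1 + eigenvalue_bound + c) * err.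
  by apply: ler_wpM2r => //; rewrite lerD2r lerD2l.
have cLe := mulr_ge0 coef0 err0.
case: kind AK upd => aK /=.
- case=> uh [fuh uhE fut ute]; split => //.
  have h1 := fixed_point_consistency oO sf Vub Vuk buk c0 D0 poincareD (ubarP FT') aK fuh uhE.
  have h2 := semi_norm_dist HL hI (feI fub) (feI fuh) (feI fut).
  apply: (le_trans h2); apply: lerD ute; apply: (le_trans h1).
  apply: (le_trans (ler_wpM2l (ltW D0) coefle)).
  by rewrite /update_constant -mulrA ler_wpM2r// lerDl ltW.
- case=> st [eh [et [feh ehE fet ete ->]]].
  have SL := @feL T'.
  have fut := lin_closedD SL fuk fet; have fuh := lin_closedD SL fuk feh.
  split => //.
  have h1 := newton_consistency oO sf Vub Vuk buk c0 (ubarP FT') aK st fuk feh ehE.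
  have h2 := semi_norm_dist HL hI (feI fub) (feI fuh) (feI fut).
  apply: (le_trans h2); apply: lerD; last first.
    by have -> : uk + eh - (uk + et) = eh - et by rewrite opprD addrACA subrr add0r.
  apply: (le_trans h1); apply: (le_trans (ler_wpM2l (ltW c0) coefle)).
  by rewrite /update_constant -mulrA ler_wpM2r// lerDr ltW.
Qed.

(** A2 is applied in the enriched space. It contains [ut], which bounds the best approximation
    error, and it contains V_H, so its [eta] is at most that of V_H. *)
Lemma step_estimate TH T T' lk uk lk1 uk1 : F TH -> F T' -> fe TH `<=` fe T' ->
  eta (fe T') <= 1 -> fe T' uk -> b_form Omega uk uk = 1 ->
  correction_step Omega f u eta approximates c kind TH T T' lk uk lk1 uk1 ->
  [/\ fe T' uk1, b_form Omega uk1 uk1 = 1,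
      norm1 (ubar T' - uk1) <= c * (update_constant * (`|lbar T' - lk| + norm0 (ubar T' - uk)) +
        c * (eta (fe T) * delta (fe T))) &
      `|lbar T' - lk1| + norm0 (ubar T' - uk1) <= c * (eta (fe TH) * norm1 (ubar T' - uk1))].
Proof.
move=> FH FT' HT' eta1 fuk buk [ut upd ap].
have [fut ute] := update_estimate FT' eta1 fuk buk upd.
have WX := enriched_sub (@feL T') HT' fut.
have Ws := enriched_subspace ut (@fe0 TH) (@feL TH).
have [h1 h2] := A2 FT' Ws WX ap.
have [[Wuk1 buk1 _] _] := ap.
have [[_ _ etam] _] := A1.
have WV : enriched (fe TH) ut `<=` V by move=> v /WX [].
have etaW := etam _ _ FH Ws (sub_enriched ut) WV.
split; [exact: WX|exact: buk1| |].
  apply: (le_trans h1); apply: (ler_wpM2l (ltW c0)).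
  apply: le_trans ute; apply: best_approx_le; exact: (enriched_mem ut (@fe0 TH)).
apply: (le_trans h2); apply: (ler_wpM2l (ltW c0)).
exact: (ler_wpM2r (sqrtr_ge0 _ : 0 <= norm1 _) etaW).
Qed.

Definition step_constant := c * (update_constant * (2 * c ^+ 2 + c) + c).

Let K_gt0 : 0 < step_constant.
Proof.
apply: mulr_gt0 => //; apply: ltr_wpDl => //; apply: mulr_ge0 => //.
by apply: addr_ge0 (ltW c0); apply: mulr_ge0 => //; exact: sqr_ge0.
Qed.

(** The summand 1 makes the smallness condition imply [eta <= 1] on V_H, hence on all levels, as
    [lbar_bound] requires. *)
Definition smallness_constant := 1 + 2 * step_constant * c + 2 * step_constant * c ^+ 2.

Let Kc_ge0 : 0 <= 2 * step_constant * c + 2 * step_constant * c ^+ 2.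
Proof.
have K2 : 0 <= 2 * step_constant := mulr_ge0 (ler0n _ 2) (ltW K_gt0).
exact: addr_ge0 (mulr_ge0 K2 (ltW c0)) (mulr_ge0 K2 (sqr_ge0 c)).
Qed.

Lemma smallness_constant_gt0 : 0 < smallness_constant.
Proof. by rewrite /smallness_constant -addrA ltr_wpDr. Qed.

Section scheme.
Variables (beta : R) (n : nat) (TH : mesh R d) (T : nat -> mesh R d).
Variables (l_ : nat -> R) (u_ : nat -> h1fun R d).
Hypotheses (beta1 : 1 < beta) (n1 : (1 <= n)%N).
Hypothesis scheme :
  multigrid_scheme Omega f u F lbar ubar eta approximates c kind beta n TH T l_ u_.
Hypothesis small : smallness_constant * beta ^+ 2 * eta (fe TH) < 1.

Let FH : F TH. Proof. by case: scheme => -[[]]. Qed.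
Let FT k : (1 <= k <= n)%N -> F (T k).
Proof. by case: scheme => -[[_ +]] => + _ _ _ _ _ _ _; exact. Qed.
Let nested k : (1 <= k < n)%N -> fe (T k) `<=` fe (T k.+1).
Proof. by case: scheme => -[_ _ + _ _ _ _ _] => /[apply] -[]. Qed.

Lemma coarse_sub k : (1 <= k <= n)%N -> fe TH `<=` fe (T k).
Proof.
elim: k => [//|[_ _|k IH /andP[_ kn]]]; first by case: scheme => -[_ []].
by apply: subset_trans (IH (ltnW kn)) _; exact: nested.
Qed.

Let feV k : fe (T k) `<=` V. Proof. by move=> v []. Qed.

Lemma eta_le_coarse k : (1 <= k <= n)%N -> eta (fe (T k)) <= eta (fe TH).
Proof.
move=> kn; have [[_ _ etam] _] := A1.
exact: (etam _ _ FH (conj (@fe0 (T k)) (@feL (T k))) (coarse_sub kn) (@feV k)).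
Qed.

Lemma eta_coarse_small : eta (fe TH) <= 1.
Proof.
apply: le_trans (ltW small); rewrite -[leLHS]mul1r; apply: ler_wpM2r => //.
have b1 : 1 <= beta ^+ 2 by rewrite expr_ge1// ltW// (lt_trans ltr01).
apply: (le_trans b1); rewrite -[leLHS]mul1r; apply: ler_wpM2r; first exact: sqr_ge0.
by rewrite /smallness_constant -addrA lerDl.
Qed.

Let eps k := norm1 (ubar (T k) - u_ k).
Let hk k := eta (fe (T k)).
Let dk k := delta (fe (T k)).

(** The last clause holds the initial value and the step of the recurrence for [eps]; the first
    three keep the induction going. At level 1 the iterate is the direct solution, so its errors
    vanish. *)
Lemma scheme_invariant k : (1 <= k <= n)%N ->
  [/\ fe (T k) (u_ k), b_form Omega (u_ k) (u_ k) = 1,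
    `|lbar (T k) - l_ k| + norm0 (ubar (T k) - u_ k) <= c * (eta (fe TH) * eps k) &
    ((k = 1)%N -> eps k = 0) /\
    (forall j, k = j.+1 -> (1 <= j)%N ->
       eps k <= step_constant * (hk j * dk j + eta (fe TH) * eps j))].
Proof.
elim: k => [//|[_ _|k IH /andP[_ kn]]].
  have [_ l1 u1 _] := scheme; have F1 := FT (n1 : (1 <= 1 <= n)%N).
  have [fu bu _] := ubarP F1.
  have e1 : eps 1 = 0 by rewrite /eps u1 subrr; exact: (semi_norm0 H0 HL hI).
  have e0 : norm0 (ubar (T 1) - u_ 1) = 0 by rewrite u1 subrr; exact: (semi_norm0 H0 HL bI).
  rewrite e0 e1 l1 subrr normr0 addr0 !mulr0 u1; split => //; split => //.
  by move=> [].
have kn' : (1 <= k.+1 < n)%N by [].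
have kn1 : (1 <= k.+1 <= n)%N by exact: ltnW kn.
have kn2 : (1 <= k.+2 <= n)%N by [].
have [fu bu erk _] := IH (ltnW kn).
have [_ _ _ /(_ _ kn') st] := scheme.
have eta1 : eta (fe (T k.+2)) <= 1.
  exact: le_trans (eta_le_coarse kn2) eta_coarse_small.
have fuk := nested kn' fu.
have [fu1 bu1 e1 e2] := step_estimate FH (FT kn2) (coarse_sub kn2) eta1 fuk bu st.
split; [exact: fu1|exact: bu1|exact: e2|split; first by []].
move=> j [<-] _; apply: (le_trans e1).
have er1 := discrete_error (FT kn1); have er2 := discrete_error (FT kn2).
have ee : eta (fe (T k.+2)) * delta (fe (T k.+2)) <= hk k.+1 * dk k.+1.
  apply: ler_pM; [exact: eta0|exact: delta0| |exact: best_approx_anti (@fe0 _) (nested kn')].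
  have [[_ _ etam] _] := A1.
  exact: (etam _ _ (FT kn1) (conj (@fe0 (T k.+2)) (@feL (T k.+2))) (nested kn') (@feV k.+2)).
have I1 := feI (ubar_fe (FT kn1)); have I2 := feI (ubar_fe (FT kn2)).
have Iu := VI uV; have Ik := feI fu.
(* Direct solutions on consecutive levels are compared through the exact eigenpair, where A1 applies
   to each. *)
have tl : `|lbar (T k.+2) - l_ k.+1| <=
    `|lambda - lbar (T k.+2)| + `|lambda - lbar (T k.+1)| + `|lbar (T k.+1) - l_ k.+1|.
  rewrite -(subrKA (lbar (T k.+1))); apply: (le_trans (ler_normD _ _)); rewrite lerD2r.
  by rewrite -(subrKA lambda); apply: (le_trans (ler_normD _ _)); rewrite distrC.
have tn : norm0 (ubar (T k.+2) - u_ k.+1) <=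
    norm0 (u - ubar (T k.+2)) + norm0 (u - ubar (T k.+1)) + norm0 (ubar (T k.+1) - u_ k.+1).
  apply: (le_trans (semi_norm_dist HL bI I2 I1 Ik)); rewrite lerD2r.
  apply: (le_trans (semi_norm_dist HL bI I2 Iu I1)).
  by rewrite (semi_norm_sub H0 HL bI I2 Iu).
have err : `|lbar (T k.+2) - l_ k.+1| + norm0 (ubar (T k.+2) - u_ k.+1) <=
    2 * c ^+ 2 * (hk k.+1 * dk k.+1) + c * (eta (fe TH) * eps k.+1).
  exact: correction_data_error tl tn er2 er1 erk ee.
apply: correction_constant err.
- exact: ltW.
- exact: K1_ge0.
- exact: mulr_ge0 (eta0 _) (delta0 _).
- exact: mulr_ge0 (eta0 _) (sqrtr_ge0 _).
Qed.

Lemma multigrid_convergence :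
  norm1 (u - u_ n) <= (c ^+ 2 + c + 1) * delta (fe (T n)) /\
  (eta_level_scaling Omega eta c beta n T ->
   `|lambda - l_ n| + norm0 (u - u_ n) <=
     (c ^+ 2 + c + 1) * (eta (fe (T n)) * delta (fe (T n)))).
Proof.
have nn : (1 <= n <= n)%N by rewrite n1 leqnn.
have FTn := FT nn.
have [fun_ bun errn _] := scheme_invariant nn.
have sm : (2 * step_constant * c + 2 * step_constant * c ^+ 2) * beta ^+ 2 * eta (fe TH) <= 1.
  apply: le_trans (ltW small); apply: ler_wpM2r => //; apply: ler_wpM2r; first exact: sqr_ge0.
  by rewrite /smallness_constant -addrA lerDr.
have e1 : eps 1 = 0 by have [_ _ _ [+ _]] := scheme_invariant (n1 : (1 <= 1 <= n)%N); exact.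
have es k : (1 <= k < n)%N -> eps k.+1 <= step_constant * (hk k * dk k + eta (fe TH) * eps k).
  move=> /andP[k1 kn].
  by have [_ _ _ [_ +]] := @scheme_invariant k.+1 kn; apply.
(* The upper half of [approx] bounds [beta^-1 * dk k] by [c * dk k.+1]; multiply by [beta]. *)
have ds k : (1 <= k < n)%N -> dk k <= c * beta * dk k.+1.
  move=> kn; have [[_ _ _ _ /(_ _ kn)/andP[_ h]] _ _ _] := scheme.
  have b0 : 0 < beta by exact: lt_trans beta1.
  by move: (ler_wpM2l (ltW b0) h); rewrite mulrA divff ?gt_eqF// mul1r mulrA [beta * c]mulrC.
have In := feI (ubar_fe FTn); have Iu := VI uV; have Iun := feI fun_.
split=> [|sc].
  have [_ /(_ _ FTn) [h1 _]] := A1.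
  apply: energy_budget (delta0 (T n)) (semi_norm_dist HL hI Iu In Iun) h1 _.
  exact: (@recurrence_energy_le _ _ _ _ _ hk dk eps n K_gt0 c0 beta1 (eta0 _) sm
    (fun k => delta0 (T k)) eta_le_coarse ds e1 es n nn).
have tl : `|lambda - l_ n| <= `|lambda - lbar (T n)| + `|lbar (T n) - l_ n|.
  by rewrite -(subrKA (lbar (T n))); exact: ler_normD.
apply: L2_budget (ltW c0) (mulr_ge0 (eta0 _) (delta0 _)) tl
  (semi_norm_dist HL bI Iu In Iun) (discrete_error FTn) errn _.
exact: (@recurrence_L2_le _ _ _ _ _ hk dk eps n K_gt0 c0 beta1 (eta0 _) sm
  (fun k => eta0 (fe (T k))) (fun k => delta0 (T k)) ds e1 es n sc nn).
Qed.

End scheme.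
End convergence.

Theorem corollary5p1 (R : realType) (d : nat) (Omega : set 'rV[R]_d)
    (f : 'rV[R]_d -> R -> R) (lambda : R) (u : h1fun R d)
    (F : set (mesh R d)) (lbar : mesh R d -> R) (ubar : mesh R d -> h1fun R d)
    (eta : set (h1fun R d) -> R)
    (approximates : set (h1fun R d) -> R -> h1fun R d -> Prop)
    (c : R) (kind : correction) :
  d = 2%N \/ d = 3%N ->
  computing_domain Omega ->
  smooth_enough Omega f ->
  is_eigenpair Omega f (H10 Omega) lambda u ->
  fe_family Omega f F lbar ubar ->
  0 < c ->
  assumption_A1 Omega lambda u F lbar ubar eta c ->
  assumption_A2 Omega f F lbar ubar eta approximates c ->
  match kind with
  | FixedPoint => assumption_B Omega f c
  | Newton => assumption_C Omega f c /\ linearization_nonsingular Omega f u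
  end ->
  exists C C' : R, [/\ 0 < C, 0 < C' &
    forall (beta : R) (n : nat) (TH : mesh R d) (T : nat -> mesh R d)
        (l_ : nat -> R) (u_ : nat -> h1fun R d),
      1 < beta -> (1 <= n)%N ->
      multigrid_scheme Omega f u F lbar ubar eta approximates c kind beta n TH T l_ u_ ->
      C * beta ^+ 2 * eta (fe_space Omega TH) < 1 ->
      h1norm Omega (u - u_ n) <= C' * best_approx Omega (fe_space Omega (T n)) u /\
      (eta_level_scaling Omega eta c beta n T ->
       `|lambda - l_ n| + l2norm Omega (u - u_ n) <=
         C' * (eta (fe_space Omega (T n)) * best_approx Omega (fe_space Omega (T n)) u))].
Proof.
(* The dimension is written as a successor because the Poincare inequality singles out a first
   coordinate. *)
move=> d23; have [e dE] : exists e, d = e.+1 by case: d23 => ->; [exists 1%N|exists 2%N].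
subst d => -[oO _ bO _] sf eu feF c0 A1 A2 AK.
have {}AK : correction_assumption Omega f c kind by case: kind AK => // -[].
have [D D0 PD] := poincare (measurable_pt_open oO) bO.
(* The constants are built from [Omega], the eigenpair, [c] and [D], before [beta], the number of
   levels and the meshes are chosen. *)
exists (smallness_constant Omega lambda u c D), (c ^+ 2 + c + 1); split.
- exact: smallness_constant_gt0.
- by rewrite ltr_wpDl// addr_ge0 ?sqr_ge0// ltW.
- move=> beta n TH T l_ u_ beta1 n1 sch sm.
  exact: (multigrid_convergence oO sf eu feF c0 A1 A2 AK D0 PD beta1 n1 sch sm).
Qed.
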